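(* Let $n\ge 0$ be an integer. A metric space $(M,d)$ is $LC^n$ if and only if it has a zero-sequence $\mathcal U=(\mathcal U_k)_{k\in\mathbb N}$ of open covers such that for every subcomplex $K$ of $\mathrm{Tel}(\mathcal U)$, any map $f_0\colon K^{(0)}\to M$ with $f_0(U)\in U$ for all $U\in K^{(0)}$ extends to a map $f\colon K^{(n+1)}\to M$ satisfying the following condition: ( * ) For any sequence $\{\sigma_k\}$ of simplexes of $K^{(n+1)}$ with $s(\sigma_k)\to\infty$ we have $\lim_{k\to\infty}\mathrm{diam}(f(\sigma_k))=0$.
   Context: All maps are continuous. A space $M$ is $LC^n$ if for every $x\in M$ and every open neighborhood $U$ of $x$ there is a neighborhood $V$ of $x$ such that every map $\mathbb S^k\to V$, $0\le k\le n$, is null-homotopic in $U$. A sequence $\mathcal U=(\mathcal U_k)_{k\in\mathbb N}$ of open covers of a metric space $(M,d)$ is a zero-sequence if $\lim_{k\to\infty}\mathrm{mesh}\,\mathcal U_k=0$, where $\mathrm{mesh}\,\mathcal U_k=\sup\{\mathrm{diam}(U):U\in\mathcal U_k\}$. For such a sequence, $\mathrm{Tel}(\mathcal U)=\bigcup_{k\in\mathbb N}N(\mathcal U_k\cup\mathcal U_{k+1})$, where $N(\mathcal U_k\cup\mathcal U_{k+1})$ is the nerve of $\mathcal U_k\cup\mathcal U_{k+1}$ with $\mathcal U_k$ and $\mathcal U_{k+1}$ considered as disjoint sets; thus vertices of $\mathrm{Tel}(\mathcal U)$ are elements of the covers $\mathcal U_k$. For a simplex $\sigma\in\mathrm{Tel}(\mathcal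 U)$, $s(\sigma)=\max\{s:\sigma\in N(\mathcal U_s\cup\mathcal U_{s+1})\}$. $K^{(m)}$ denotes the $m$-skeleton of a simplicial complex $K$; a map defined on $K^{(m)}$ means a map on its geometric realization. *)

(* Defs.v *)
From HB Require Import structures.
From mathcomp Require Import all_boot all_order all_algebra finmap.
From mathcomp Require Import all_classical all_reals all_analysis.

Set Implicit Arguments.
Unset Strict Implicit.
Unset Printing Implicit Defensive.

Import Order.TTheory GRing.Theory Num.Theory.
Import numFieldNormedType.Exports.

Local Open Scope classical_set_scope.
Local Open Scope ring_scope.

Section local_connectedness.
Variable R : realType.

Definition sphere (k : nat) : set 'rV[R]_k.+1 :=
  [set x | \sum_i x ord0 i ^+ 2 = 1].
Arguments sphere : clear implicits.

(* A map out of [sphere k] is a total function on the ambient space of which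
   only the restriction to the sphere matters. *)
Definition null_homotopic_in (M : topologicalType) (k : nat) (U : set M)
    (f : 'rV[R]_k.+1 -> M) :=
  exists (H : R * 'rV[R]_k.+1 -> M) (c : M),
    [/\ {within `[0, 1]%classic `*` sphere k, continuous H},
        forall t x, 0 <= t <= 1 -> sphere k x -> U (H (t, x)),
        forall x, sphere k x -> H (0, x) = f x &
        forall x, sphere k x -> H (1, x) = c].

Definition LC (n : nat) (M : topologicalType) :=
  forall (x : M) (U : set M), open U -> U x ->
  exists2 V : set M, nbhs x V &
    forall (k : nat) (f : 'rV[R]_k.+1 -> M), (k <= n)%N ->
      {within sphere k, continuous f} -> f @` sphere k `<=` V ->
      null_homotopic_in U f.

End local_connectedness.
Arguments sphere : clear implicits.

Section simplicial_complexes.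
Variable V : choiceType.
Implicit Types (K L : set {fset V}) (s t : {fset V}).

Definition is_complex K :=
  forall s, K s -> s != fset0 /\
    forall t, t != fset0 -> (t `<=` s)%fset -> K t.

Definition subcomplex K L := is_complex K /\ K `<=` L.

Definition skeleton (m : nat) K : set {fset V} :=
  [set s | K s /\ (#|` s| <= m.+1)%N].

Lemma skeletonS (m n : nat) K : (m <= n)%N -> skeleton m K `<=` skeleton n K.
Proof. by move=> mn s [Ks sm]; split=> //; apply: leq_trans sm _. Qed.

End simplicial_complexes.

Section geometric_realization.
Variables (R : realType) (V : choiceType).
Implicit Types (K L : set {fset V}).

(* Points are given by their barycentric coordinates. *)
Record realization K := Realization {
  bary :> V -> R ;
  bary_ge0 : forall v, 0 <= bary v ;
  bary_simplex : exists2 s, K s &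
    (forall v, v \notin s -> bary v = 0) /\ \sum_(v <- s) bary v = 1 }.

HB.instance Definition _ K := gen_eqMixin (realization K).
HB.instance Definition _ K := gen_choiceMixin (realization K).

Definition closed_simplex K (s : {fset V}) : set (realization K) :=
  [set x | forall v, v \notin s -> x v = 0].
Arguments closed_simplex {K} s.

(* Whitehead topology: a set is open iff its trace on each closed simplex is
   relatively open; on a closed simplex the topology of pointwise convergence
   of the barycentric coordinates is the Euclidean one. *)
Definition realization_open K (A : set (realization K)) :=
  forall s, K s -> exists2 O : set (prod_topology (fun _ : V => R)), open O &
    A `&` closed_simplex s = (@bary K) @^-1` O `&` closed_simplex s.

Lemma realization_openT K : realization_open (@setT (realization K)).
Proof. by move=> s _; exists setT; [exact: openT | rewrite preimage_setT]. Qed.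

Lemma realization_openI K : setI_closed (@realization_open K).
Proof.
move=> A B Ao Bo s Ks.
have [Q Qo AQ] := Ao s Ks; have [P Po BP] := Bo s Ks.
exists (Q `&` P); first exact: openI.
by rewrite preimage_setI setIIl AQ BP -setIIl.
Qed.

Lemma realization_open_bigU K (I : Type) (A : I -> set (realization K)) :
  (forall i, realization_open (A i)) -> realization_open (\bigcup_i A i).
Proof.
move=> Ao s Ks.
pose O i := sval (cid2 (Ao i s Ks)).
have Oo i : open (O i) by rewrite /O; case: cid2.
have AO i : A i `&` closed_simplex s = (@bary K) @^-1` O i `&` closed_simplex s.
  by rewrite /O; case: cid2.
exists (\bigcup_i O i); first by apply: bigcup_open => i _; exact: Oo.
rewrite preimage_bigcup !setI_bigcupl.
by apply: eq_bigcupr => i _; exact: AO.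
Qed.

HB.instance Definition _ K := isOpenTopological.Build (realization K)
  (@realization_openT K) (@realization_openI K) (@realization_open_bigU K).

Lemma vertex_subproof K (v : V) : K [fset v]%fset ->
  exists2 s : {fset V}, K s &
    (forall w, w \notin s -> (w == v)%:R = 0 :> R) /\
    \sum_(w <- s) (w == v)%:R = 1 :> R.
Proof.
move=> Kv; exists [fset v]%fset => //; split; last first.
  by rewrite big_seq_fset1 eqxx.
by move=> w; rewrite inE => /negPf ->.
Qed.

Definition vertex K (v : V) (Kv : K [fset v]%fset) : realization K :=
  Realization (fun w => ler0n R (w == v)) (vertex_subproof Kv).

Lemma incl_subproof K L (KL : K `<=` L) (x : realization K) :
  exists2 s, L s &
    (forall v, v \notin s -> x v = 0) /\ \sum_(v <- s) x v = 1.
Proof. by have [s /KL Ls sx] := bary_simplex x; exists s. Qed.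

Definition realization_incl K L (KL : K `<=` L) (x : realization K) :
    realization L :=
  Realization (bary_ge0 x) (incl_subproof KL x).

End geometric_realization.

Section telescope.
Variable M : Type.

(* [(k, W)] is the member [W] of the [k]-th cover; the index keeps the covers
   disjoint. *)
Definition labelled (U : nat -> set (set M)) (k : nat) : set (nat * set M) :=
  [set v | v.1 = k /\ U k v.2].

Definition nerve (C : set (nat * set M)) : set {fset nat * set M} :=
  [set s | [/\ s != fset0, [set` s] `<=` C &
               \bigcap_(v in [set` s]) v.2 !=set0]].

Definition nerve_pair (U : nat -> set (set M)) (k : nat) :=
  nerve (labelled U k `|` labelled U k.+1).

Definition Tel (U : nat -> set (set M)) : set {fset nat * set M} :=
  \bigcup_k nerve_pair U k.

(* The maximum exists for simplexes of [Tel U]; [0] is a junk value elsewhere. *)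
Definition level (U : nat -> set (set M)) (s : {fset nat * set M}) : nat :=
  xget 0%N [set k | nerve_pair U k s /\ forall l, nerve_pair U l s -> (l <= k)%N].

End telescope.

Section zero_sequences.
Variables (R : realType) (M : metricType R).
Local Open Scope ereal_scope.

(* Adjoining [0] gives the empty set diameter [0], not [-oo]; likewise for
   the mesh of the empty family. *)
Definition diam (A : set M) : \bar R :=
  ereal_sup (0 |` [set (mdist z.1 z.2)%:E | z in A `*` A]).

Definition mesh (C : set (set M)) : \bar R := ereal_sup (0 |` (diam @` C)).

Definition open_cover (C : set (set M)) :=
  C `<=` open /\ \bigcup_(W in C) W = setT.

Definition zero_sequence (U : nat -> set (set M)) :=
  (forall k, open_cover (U k)) /\ mesh (U k) @[k --> \oo] --> 0.

End zero_sequences.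

(* Main.v *)
Require Import Defs.
From mathcomp Require Import all_boot all_order all_algebra finmap.
From mathcomp Require Import all_classical all_reals all_analysis.
From mathcomp Require Import ring lra zify.
Set Implicit Arguments.
Unset Strict Implicit.
Unset Printing Implicit Defensive.
Import Order.TTheory GRing.Theory Num.Theory.
Import numFieldNormedType.Exports.
Local Open Scope classical_set_scope.
Local Open Scope ring_scope.

(** The two implications use different geometry.

    From [LC] to extensions.  Local connectedness is turned into functions
    [radius n k j] on [M], positive and 1-Lipschitz, such that a sphere of
    dimension at most [n] lying within [radius n k j.+1 x] of [x] contracts in
    a set whose diameter is at most a quarter of the value of [radius n k j]
    at any of its points; [radius n k 0] is the constant [1 / (k + 1)].  The
    Lipschitz condition lets a bound at one point of a simplex be moved to
    another point, which is what star refinements of covers usually do.  The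
    [k]-th cover consists of the open sets whose diameter is at most a twelfth
    of [radius n k n.+1] at each of their points.  A choice of points in the
    members of the covers is then extended cell by cell: when the [m]-skeleton
    is done, the boundary of an [(m+1)]-cell lies in a ball of the current
    radius, so it bounds ([cone_extension]), and the image of the new cell is
    again small for the next radius.  At the last stage images of cells of level
    [k] have diameter at most a quarter of [1 / (k + 1)], which gives the
    condition on diameters ([LC_extension]).

    From extensions to [LC].  Fix a map [f] on the whole [(n+1)]-skeleton of
    the telescope.  Let [h] map the [k]-sphere, [k <= n], into a member [W0] of
    the [J]-th cover.  The space of dimension [k+1] has an open cover of order
    at most [k+2] by stars of lattice points ([hat], the Freudenthal
    triangulation).  A lattice point [v] is sent to a member of a cover that
    contains the [h]-image of all directions [x / |x|] with [x] in the star of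
    [v].  Far away a star is seen from the origin under a small angle, so the
    cover may have a high index; near the origin [W0] itself serves.  If the
    index grows slowly, neighbouring lattice points have indices that differ
    by at most one, and the partition of unity gives a map of Euclidean space
    into the [(n+1)]-skeleton of the telescope ([partition_map]).  Composed
    with [f] it becomes a map [g] of Euclidean space for which [g x] is close
    to [h (x / |x|)], and arbitrarily close as [x] goes to infinity.  Thus
    [g] and [h] together are a map of the closed ball that extends [h] and has
    values near those of [h] ([null_homotopic_of_radial_limit]). *)

(** * Limits in products and spaces of matrices *)

Section limits.
Variable R : realType.

Lemma cvg_near_eq (T : Type) (U : topologicalType) (F : set_system T)
    {FF : Filter F} (f g : T -> U) (l : U) :
  (\forall x \near F, f x = g x) -> f x @[x --> F] --> l -> g x @[x --> F] --> l.
Proof.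
move=> fg fl A lA; have := fl A lA; rewrite /nbhs /=.
by apply: filterS2 fg => x /= <-.
Qed.

Lemma cvg_couple (T : Type) (U W : topologicalType) (F : set_system T)
    {FF : Filter F} (f : T -> U) (g : T -> W) (a : U) (b : W) :
  f x @[x --> F] --> a -> g x @[x --> F] --> b ->
  (f x, g x) @[x --> F] --> ((a, b) : (U * W)%type).
Proof.
move=> fa gb A [[B C] /= [aB bC] BC]; have := fa B aB; have := gb C bC.
by rewrite /nbhs /=; apply: filterS2 => x gx fx; exact: BC.
Qed.

Lemma cvg_row (T : Type) (F : set_system T) {FF : Filter F} m
    (f : 'I_m -> T -> R) (a : 'I_m -> R) :
  (forall j, f j x @[x --> F] --> a j) ->
  (\row_j f j x) @[x --> F] --> \row_j a j.
Proof.
move=> fa A [P aP PA].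
have : \forall x \near F, forall j : 'I_m, P ord0 j (f j x).
  apply: filter_forall => j; apply: fa.
  by have := aP ord0 j; rewrite mxE.
apply: filterS => x Px; apply: PA => i j; rewrite mxE ord1; exact: Px.
Qed.

Lemma cvg_ptws (V T : Type) (F : set_system T) {FF : Filter F}
    (f : T -> V -> R) (a : V -> R) :
  (forall v, f x v @[x --> F] --> a v) ->
  (f x : prod_topology (fun _ : V => R)) @[x --> F] -->
    (a : prod_topology (fun _ : V => R)).
Proof.
move=> fa; apply/cvg_sup => v; apply/cvg_image => //.
  by apply/seteqP; split=> // y _; exists (fun=> y).
move=> B aB; exists [set y | B (y v)]; first exact: (fa v B aB).
by apply/seteqP; split=> [_ [y By <-] //|y By]; exists (fun=> y).
Qed.

Lemma ptws_coord_continuous (V : choiceType) (v : V) :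
  continuous (fun x : prod_topology (fun _ : V => R) => x v).
Proof. exact: (@proj_continuous V (fun=> (R : topologicalType)) v). Qed.

Lemma min_continuous2 : continuous (fun p : R * R => Num.min p.1 p.2).
Proof.
move=> p; apply: (@continuous_min R (R * R)%type fst snd);
  [exact: cvg_fst | exact: cvg_snd].
Qed.

Lemma cvg_bigmin (T I : Type) (F : set_system T) {FF : Filter F} (r : seq I)
    (x0 : R) (f : I -> T -> R) (a : I -> R) :
  (forall i, f i x @[x --> F] --> a i) ->
  \big[Num.min/x0]_(i <- r) f i x @[x --> F] --> \big[Num.min/x0]_(i <- r) a i.
Proof. by move=> fa; apply: cvg_big => // ; exact: min_continuous2. Qed.

Lemma cvg_bigsum (T I : Type) (F : set_system T) {FF : Filter F} (r : seq I)
    (f : I -> T -> R) (a : I -> R) :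
  (forall i, f i x @[x --> F] --> a i) ->
  \sum_(i <- r) f i x @[x --> F] --> \sum_(i <- r) a i.
Proof. by move=> fa; apply: cvg_big => //; exact: add_continuous. Qed.

Lemma bigmin_attained (I : eqType) (r : seq I) (x0 : R) (f : I -> R) :
  \big[Num.min/x0]_(i <- r) f i = x0 \/
  exists2 i, i \in r & \big[Num.min/x0]_(i <- r) f i = f i.
Proof.
elim: r => [|i r [IH|[j jr IH]]]; first by left; rewrite big_nil.
- rewrite big_cons IH /Num.min; case: ifP => _; last by left.
  by right; exists i; rewrite ?mem_head.
- rewrite big_cons IH /Num.min; case: ifP => _; right.
    by exists i; rewrite ?mem_head.
  by exists j; rewrite // inE jr orbT.
Qed.

End limits.

(** * Directions in Euclidean space *)
Section directions.
Variables (R : realType) (k : nat).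
Implicit Types x y : 'rV[R]_k.+1.

Definition enorm x := Num.sqrt (\sum_i x ord0 i ^+ 2).

(** The value at [0] is an arbitrary point of the sphere, so that [dir] is total. *)
Definition dir x : 'rV[R]_k.+1 :=
  if x == 0 then delta_mx ord0 ord0 else (enorm x)^-1 *: x.

Lemma sumsq_ge0 x : 0 <= \sum_i x ord0 i ^+ 2.
Proof. by apply: sumr_ge0 => i _; rewrite sqr_ge0. Qed.

Lemma enorm_gt0 x : x != 0 -> 0 < enorm x.
Proof.
move=> x0; rewrite sqrtr_gt0 lt_neqAle sumsq_ge0 andbT eq_sym.
apply: contra x0; rewrite psumr_eq0 => [/allP x0|i _]; last exact: sqr_ge0.
apply/eqP/rowP => i; rewrite mxE; apply/eqP; rewrite -(sqrf_eq0 (x ord0 i)).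
by have := x0 i; rewrite mem_index_enum => /(_ isT).
Qed.

Lemma enormZ (a : R) x : 0 <= a -> enorm (a *: x) = a * enorm x.
Proof.
move=> a0; rewrite /enorm.
under eq_bigr do rewrite mxE exprMn.
by rewrite -mulr_sumr sqrtrM ?sqr_ge0 // sqrtr_sqr ger0_norm.
Qed.

Lemma sphereE x : sphere R k x <-> enorm x = 1.
Proof.
rewrite /sphere /enorm /=; split => [->|]; first by rewrite sqrtr1.
by move=> h; rewrite -(sqr_sqrtr (sumsq_ge0 x)) h expr1n.
Qed.

Lemma sphere_neq0 x : sphere R k x -> x != 0.
Proof.
move/sphereE; apply: contra_eq_neq => ->; rewrite /enorm big1 ?sqrtr0.
  by rewrite eq_sym oner_eq0.
by move=> i _; rewrite mxE expr0n.
Qed.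

Lemma dir_sphere x : sphere R k (dir x).
Proof.
rewrite /dir; case: eqVneq => [_|x0].
  rewrite /sphere /= (bigD1 ord0) //= mxE !eqxx expr1n big1 ?addr0 //.
  by move=> i i0; rewrite mxE (negPf i0) andbF expr0n.
apply/sphereE; rewrite enormZ ?invr_ge0 ?sqrtr_ge0 // mulVf //.
by rewrite gt_eqF // enorm_gt0.
Qed.

Lemma dirZ (a : R) x : 0 < a -> dir (a *: x) = dir x.
Proof.
move=> a0; rewrite /dir scaler_eq0 gt_eqF //=; case: eqVneq => // x0.
by rewrite enormZ ?ltW // invfM scalerA mulrC mulrA mulfV ?gt_eqF // mul1r.
Qed.

Lemma dir_id x : sphere R k x -> dir x = x.
Proof.
move=> /[dup] /sphereE x1 /sphere_neq0 x0.
by rewrite /dir (negPf x0) x1 invr1 scale1r.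
Qed.

Lemma enorm_continuous : continuous enorm.
Proof.
move=> x; apply: (@continuous_comp _ _ _ (fun x => \sum_i x ord0 i ^+ 2)); last first.
  exact: sqrt_continuous.
apply: (@cvg_bigsum R _ _ (nbhs x)) => i.
under [X in X @ _ --> _]eq_fun do rewrite expr2.
by rewrite expr2; apply: cvgM; exact: (@coord_continuous R 1 k.+1 ord0 i x).
Qed.

Lemma dir_continuous x : x != 0 -> dir y @[y --> x] --> dir x.
Proof.
move=> x0; have nx : \forall y \near x, y != 0.
  have : \forall y \near x, 0 < enorm y.
    apply: (@cvgr_gt R _ (nbhs x) _ enorm (enorm x)); [exact: enorm_continuous | exact: enorm_gt0].
  apply: filterS => y; apply: contraTneq => ->.
  by rewrite /enorm big1 ?sqrtr0 ?ltxx // => i _; rewrite mxE expr0n.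
apply: (@cvg_near_eq _ _ (nbhs x) _ (fun y => (enorm y)^-1 *: y)).
  by apply: filterS nx => y y0; rewrite /dir (negPf y0).
rewrite /dir (negPf x0); apply: cvgZ; last exact: cvg_id.
by apply: cvgV; [rewrite gt_eqF // enorm_gt0 | exact: enorm_continuous].
Qed.

Lemma sphere_nonempty : exists x, sphere R k x.
Proof. by exists (dir 0); exact: dir_sphere. Qed.

Lemma coord_le_norm x i : `|x ord0 i| <= `|x|.
Proof.
rewrite [X in _ <= X]mx_normrE.
by have := @le_bigmax _ _ _ 0 (fun ij : 'I_1 * 'I_k.+1 => `|x ij.1 ij.2|) (ord0, i).
Qed.

Lemma norm_le_coord x r : 0 <= r -> (forall i, `|x ord0 i| <= r) -> `|x| <= r.
Proof.
move=> r0 xr; rewrite [X in X <= _]mx_normrE; apply: bigmax_le => // -[i j] _ /=.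
by rewrite ord1.
Qed.

Lemma sphere_coord_le x i : sphere R k x -> `|x ord0 i| <= 1.
Proof.
move=> sx; have : x ord0 i ^+ 2 <= 1.
  by rewrite -sx (bigD1 i) //= lerDl sumr_ge0 // => j _; rewrite sqr_ge0.
by rewrite -real_normK ?num_real // -[X in _ <= X](expr1n R 2) ler_pXn2r ?nnegrE.
Qed.

Lemma sphere_compact : compact (sphere R k).
Proof.
apply: bounded_closed_compact.
  exists 1; split; first exact: num_real.
  move=> M M1 x sx; apply: le_trans (ltW M1).
  by apply: norm_le_coord => // i; exact: sphere_coord_le.
rewrite (_ : sphere R k = enorm @^-1` [set 1]).
  apply: preimage_closed; last exact: closed_eq.
  by move=> x _; exact: enorm_continuous.
by apply/seteqP; split=> x /sphereE.
Qed.

End directions.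

(** * Cells, and extension from the boundary of a cell *)
Section cells.
Variables (R : realType) (V : choiceType).
Local Notation pt := (prod_topology (fun _ : V => R)).
Implicit Types (s t : {fset V}) (x y : pt).

(** Cells live in the space of all functions on the vertices.  Maps on skeleta
    are restrictions of functions on this one space, so that passing from a
    skeleton to the next one does not change the domain. *)
Definition cell s : set pt :=
  [set x | [/\ forall v, 0 <= x v, forall v, v \notin s -> x v = 0 &
               \sum_(v <- s) x v = 1]].

Definition cell_boundary s : set pt :=
  [set x | cell s x /\ exists2 v, v \in s & x v = 0].

Lemma sum_fset_support s t (f : V -> R) :
  (forall v, v \notin s -> f v = 0) -> (forall v, v \notin t -> f v = 0) ->
  \sum_(v <- s) f v = \sum_(v <- t) f v.
Proof.
move=> fs ft.
have st : (s `<=` s `|` t)%fset by exact: fsubsetUl.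
have ts : (t `<=` s `|` t)%fset by exact: fsubsetUr.
rewrite (big_fset_incl _ st) => [|v _ /fs //].
by rewrite [RHS](big_fset_incl _ ts) => [|v _ /ft //].
Qed.

Lemma cellW s t x : cell s x -> (forall v, v \notin t -> x v = 0) -> cell t x.
Proof.
by move=> [x0 xs x1] xt; split => //; rewrite -x1; apply: sum_fset_support.
Qed.

End cells.

(** Singling out one vertex [w] of a simplex leaves as many vertices as the
    space of its boundary sphere has coordinates. *)
Lemma fset_coordinates (V : choiceType) (k : nat) (s : {fset V}) :
  #|` s| = k.+2 ->
  exists w (vtx : 'I_k.+1 -> V) (idx : V -> option 'I_k.+1),
    [/\ w \in s, idx w = None, forall j, vtx j \in s,
        forall j, idx (vtx j) = Some j &
        forall v, v \in s -> v != w -> exists2 j, vtx j = v & idx v = Some j].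
Proof.
move=> sk; have /fset0Pn [w ws] : s != fset0 by rewrite -cardfs_gt0 sk.
have rk : size (enum_fset (s `\ w)%fset) = k.+1.
  by have := cardfsD1 w s; rewrite ws sk add1n => -[->].
exists w, (fun j => nth w (s `\ w)%fset j),
  (fun v => insub (index v (enum_fset (s `\ w)%fset))).
have idxE v : v \in (s `\ w)%fset ->
    exists2 j : 'I_k.+1, nth w (s `\ w)%fset j = v &
      insub (index v (enum_fset (s `\ w)%fset)) = Some j.
  move=> vs; have vk : (index v (enum_fset (s `\ w)%fset) < k.+1)%N.
    by rewrite -rk index_mem.
  by exists (Ordinal vk); [rewrite /= nth_index | rewrite insubT].
have memj (j : 'I_k.+1) : nth w (s `\ w)%fset j \in (s `\ w)%fset.
  by rewrite mem_nth // rk.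
split => // [|j|j|v vs vw].
- rewrite insubN // -leqNgt -rk leqNgt index_mem.
  by apply/negP; rewrite !inE eqxx.
- by have := memj j; rewrite !inE => /andP[].
- by rewrite index_uniq ?rk // insubT // => lj; congr Some; apply: val_inj.
- by apply: idxE; rewrite !inE vw.
Qed.

Section cone_extension.
Variables (R : realType) (V : choiceType) (k : nat) (s : {fset V}).
Variables (w : V) (vtx : 'I_k.+1 -> V) (idx : V -> option 'I_k.+1).
Hypotheses (ws : w \in s) (idxw : idx w = None)
  (vtxs : forall j, vtx j \in s) (vtxK : forall j, idx (vtx j) = Some j)
  (idxP : forall v, v \in s -> v != w -> exists2 j, vtx j = v & idx v = Some j).
Hypothesis (sk : #|` s| = k.+2).
Local Notation pt := (prod_topology (fun _ : V => R)).
Implicit Types (x : pt) (z : 'rV[R]_k.+1).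

(** Differences with the coordinate at [w] map the hyperplane of the cell to
    Euclidean space and the barycentre to [0].  On the boundary of the cell,
    where the least coordinate is [0], [bd] inverts [diffs] up to a positive
    factor: subtracting the least coordinate restores the missing constant and
    dividing by the sum restores the scale. *)
Let diffs x : 'rV[R]_k.+1 := \row_j (x (vtx j) - x w).
Let ext z (v : V) : R := if idx v is Some j then z ord0 j else 0.
Let low z : R := \big[Num.min/0]_(v <- s) ext z v.
Let mass z : R := \sum_(v <- s) (ext z v - low z).
Let bd z : pt := fun v => if v \in s then (ext z v - low z) / mass z else 0.

Let ext_diffs (a : R) x v : v \in s -> ext (a *: diffs x) v = a * (x v - x w).
Proof.
move=> vs; rewrite /ext; have [->|vw] := eqVneq v w.
  by rewrite idxw subrr mulr0.
by have [j <- ->] := idxP vs vw; rewrite !mxE.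
Qed.

Let low_le z v : v \in s -> low z <= ext z v.
Proof. by move=> vs; apply: ge_bigmin_seq. Qed.

Let low_attained z : exists2 v, v \in s & low z = ext z v.
Proof.
rewrite /low; have [->|//] := bigmin_attained s 0 (ext z).
by exists w; rewrite // /ext idxw.
Qed.

Let mass_gt0 z : z != 0 -> 0 < mass z.
Proof.
move=> z0; have pos v : v \in s -> 0 <= ext z v - low z.
  by move=> vs; rewrite subr_ge0 low_le.
rewrite lt_neqAle /mass big_seq sumr_ge0 // andbT eq_sym.
apply: contra z0; rewrite psumr_eq0 // => /allP z0.
have {}z0 v : v \in s -> ext z v = low z.
  by move=> vs; have := z0 v vs; rewrite vs subr_eq0 => /eqP.
apply/eqP/rowP => j; rewrite mxE; have := z0 _ (vtxs j).
by rewrite -(z0 _ ws) /ext vtxK idxw.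
Qed.

Let bd_boundary z : z != 0 -> cell_boundary s (bd z).
Proof.
move=> /mass_gt0 m0; split; last first.
  have [v vs lv] := low_attained z; exists v => //.
  by rewrite /bd vs lv subrr mul0r.
split=> [v|v /negPf vs|]; last 2 first.
- by rewrite /bd vs.
- rewrite big_seq; under eq_bigr => v vs do rewrite /bd vs.
  by rewrite -big_seq -mulr_suml divff // gt_eqF.
rewrite /bd; case: ifP => // vs; apply: divr_ge0; last exact: ltW.
by rewrite subr_ge0 low_le.
Qed.

Let bd_diffs (a : R) x : 0 < a -> cell_boundary s x -> bd (a *: diffs x) = x.
Proof.
move=> a0 [[x0 xs x1] [u us xu]]; set z := a *: diffs x.
have lowE : low z = - (a * x w).
  have [v vs lv] := low_attained z.
  have := low_le z us; have := x0 v; rewrite lv !ext_diffs // xu.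
  rewrite sub0r !mulrBr mulrN => xv; rewrite lerBlDr addNr => xuv.
  have axv : 0 <= a * x v by apply: mulr_ge0 => //; exact: ltW.
  have -> : a * x v = 0 by apply/eqP; rewrite eq_le axv xuv.
  by rewrite sub0r.
have extE v : v \in s -> ext z v - low z = a * x v.
  by move=> vs; rewrite lowE ext_diffs //; ring.
have massE : mass z = a.
  rewrite /mass big_seq; under eq_bigr => v vs do rewrite extE //.
  by rewrite -big_seq -mulr_sumr x1 mulr1.
apply/funext => v; rewrite /bd; case: ifPn => [vs|/xs //].
by rewrite extE // massE mulrAC mulfV ?mul1r // gt_eqF.
Qed.

Let bd_continuous z : z != 0 -> bd y @[y --> z] --> bd z.
Proof.
move=> z0.
have cext v : ext y v @[y --> z] --> ext z v.
  rewrite /ext; case: (idx v) => [j|]; last by apply: (@cvg_cst R 0 _ (nbhs z) _).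
  exact: (@coord_continuous R 1 k.+1 ord0 j z).
have clow : low y @[y --> z] --> low z by apply: (@cvg_bigmin R _ _ (nbhs z)).
apply: (@cvg_ptws _ _ _ (nbhs z)) => v; rewrite /bd; case: (v \in s); last exact: (@cvg_cst R 0 _ (nbhs z) _).
apply: (@cvgM _ _ (nbhs z)); first by apply: (@cvgB _ _ _ (nbhs z)).
apply: (@cvgV _ _ (nbhs z)); first by rewrite gt_eqF // mass_gt0.
by apply: (@cvg_bigsum R _ _ (nbhs z)) => u; apply: (@cvgB _ _ _ (nbhs z)).
Qed.

Let diffs_continuous : continuous diffs.
Proof.
move=> x; apply: (@cvg_row R _ (nbhs x)) => j.
by apply: (@cvgB _ _ _ (nbhs x)); exact: ptws_coord_continuous.
Qed.

Let diffs_eq0 x : cell s x -> diffs x = 0 -> forall v, v \in s -> x v = k.+2%:R^-1.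
Proof.
move=> [x0 xs x1] d0; have xw v : v \in s -> x v = x w.
  move=> vs; have := ext_diffs 1 x vs; rewrite d0 scaler0 mul1r /ext.
  case: (idx v) => [j|]; rewrite ?mxE => /eqP;
  by rewrite eq_sym subr_eq0 => /eqP.
have k0 : k.+2%:R != 0 :> R by rewrite pnatr_eq0.
move=> v vs; apply: (mulIf k0); rewrite mulVf // xw // -[RHS]x1.
rewrite big_seq; under eq_bigr => u us do rewrite xw //.
by rewrite -big_seq big_const_seq count_predT iter_addr_0 sk mulr_natr.
Qed.

(** The cell is a cone over its boundary: the least coordinate grows from [0] on
    the boundary to [1 / (k + 2)] at the barycentre.  The factor [2] makes
    [depth] equal to [1] on a neighbourhood of the barycentre, where the
    direction of [diffs x] has no limit. *)
Let depth x : R := Num.min 1 (2 * k.+2%:R * \big[Num.min/1]_(v <- s) x v).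

Let depth_continuous : continuous depth.
Proof.
move=> x; rewrite /depth.
apply: (@continuous_min R pt (fun=> 1) (fun x => 2 * k.+2%:R * \big[Num.min/1]_(v <- s) x v)).
  exact: (@cvg_cst R 1 _ (nbhs x) _).
apply: (@cvgM _ _ (nbhs x)); first exact: (@cvg_cst R (2 * k.+2%:R) _ (nbhs x) _).
by apply: (@cvg_bigmin R _ _ (nbhs x)) => v; exact: ptws_coord_continuous.
Qed.

Let depth01 x : cell s x -> 0 <= depth x <= 1.
Proof.
move=> [x0 _ _]; rewrite /depth ge_min lexx /= le_min ler01 /= !mulr_ge0 //.
by apply: le_bigmin.
Qed.

Let depth_boundary x : cell_boundary s x -> depth x = 0.
Proof.
move=> [sx [v vs xv]]; have /andP[d0 _] := depth01 sx.
apply/eqP; rewrite eq_le d0 andbT /depth ge_min; apply/orP; right.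
have : \big[Num.min/1]_(v <- s) x v <= 0 by rewrite -[leRHS]xv; apply: ge_bigmin_seq.
by rewrite -!oppr_ge0 -mulrN => ?; rewrite mulr_ge0 // mulr_ge0.
Qed.

Let depth_center x : cell s x -> diffs x = 0 -> \forall y \near x, depth y = 1.
Proof.
move=> sx d0.
pose f (y : pt) : R := 2 * k.+2%:R * \big[Num.min/1]_(v <- s) y v.
have fx : 1 < f x.
  rewrite /f; have -> : \big[Num.min/1]_(v <- s) x v = k.+2%:R^-1.
    have [E|[v vs ->]] := bigmin_attained s 1 x; last exact: diffs_eq0.
    apply/eqP; rewrite eq_le; apply/andP; split.
      by rewrite -(diffs_eq0 sx d0 ws); apply: ge_bigmin_seq.
    by rewrite E invf_le1 ?ler1n // ltr0n.
  by rewrite mulfK ?ltr1n // pnatr_eq0.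
have fc : f y @[y --> x] --> f x.
  apply: (@cvgM _ _ (nbhs x)); first exact: (@cvg_cst R (2 * k.+2%:R) _ (nbhs x) _).
  by apply: (@cvg_bigmin R _ _ (nbhs x)) => v; exact: ptws_coord_continuous.
apply: (@filterS _ (nbhs x) _ _ _ _ (@cvgr_gt R _ (nbhs x) _ f (f x) fc 1 fx)).
by move=> y fy; rewrite /depth; apply/min_idPl; exact: ltW.
Qed.

(** A null-homotopy of the boundary sphere, run along the rays from the boundary
    to the barycentre, fills the cell. *)
Lemma cone_extension_coordinates : exists q : 'rV[R]_k.+1 -> pt,
  [/\ {within sphere R k, continuous q},
      forall z, sphere R k z -> cell_boundary s (q z) &
      forall (M : topologicalType) (f : pt -> M) (A : set M),
        null_homotopic_in A (f \o q) ->
        exists G : pt -> M, [/\ {within cell s, continuous G},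
          forall x, cell_boundary s x -> G x = f x &
          forall x, cell s x -> A (G x)]].
Proof.
exists bd; split => [|z /sphere_neq0 /bd_boundary //|].
  apply: continuous_in_subspaceT => z; rewrite inE => /sphere_neq0.
  exact: bd_continuous.
move=> M f A [H [c [Hc HA H0 H1]]].
pose G x : M := if diffs x == 0 then c else H (depth x, dir (diffs x)).
have [e es] := sphere_nonempty R k.
exists G; split => [|x xb|x sx]; last 2 first.
- have x0 : diffs x != 0.
    apply: contraPneq xb => d0 [sx [v vs xv]].
    have := diffs_eq0 sx d0 vs; rewrite xv => /eqP.
    by rewrite eq_sym invr_eq0 pnatr_eq0.
  rewrite /G (negPf x0) depth_boundary // H0; last exact: dir_sphere.
  rewrite /= /dir (negPf x0) bd_diffs // invr_gt0; exact: enorm_gt0.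
- rewrite /G; case: ifP => _; last by apply: HA (depth01 sx) (dir_sphere _).
  by rewrite -(H1 e es); apply: HA => //; rewrite ler01 lexx.
apply/subspace_continuousP => x sx; have [d0|d0] := eqVneq (diffs x) 0.
  (* near the barycentre both branches of [G] give the final point [c] *)
  apply: (@cvg_near_eq _ _ (within (cell s) (nbhs x)) _ (fun=> G x)); last exact: cvg_cst.
  have := depth_center sx d0; rewrite near_withinE; apply: filterS => y dy sy.
  by rewrite /G d0 eqxx dy; case: ifP => // _; rewrite H1 //; exact: dir_sphere.
have nd : \forall y \near x, diffs y != 0.
  have := @diffs_continuous x [set z | z != 0]; apply.
  have : \forall z \near diffs x, 0 < enorm z.
    apply: (@cvgr_gt R _ (nbhs (diffs x)) _ (@enorm R k) (enorm (diffs x))).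
      exact: enorm_continuous.
    exact: enorm_gt0.
  apply: filterS => y; apply: contraTneq => ->.
  by rewrite /enorm big1 ?sqrtr0 ?ltxx // => i _; rewrite mxE expr0n.
apply: (@cvg_near_eq _ _ (within (cell s) (nbhs x)) _
  (fun y => H (depth y, dir (diffs y)))).
  rewrite near_withinE; apply: filterS nd => y dy _.
  by rewrite /G (negPf dy).
move/subspace_continuousP : Hc => Hc.
have GE : G x = H (depth x, dir (diffs x)) by rewrite /G (negPf d0).
rewrite /from_subspace GE.
apply: cvg_comp (Hc (depth x, dir (diffs x)) _); last first.
  by split; [rewrite /= in_itv; exact: depth01 | exact: dir_sphere].
move=> B; rewrite /within /= => HB.
have : \forall y \near x, (`[0, 1] `*` sphere R k) (depth y, dir (diffs y)) ->
    B (depth y, dir (diffs y)).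
  have dc : ((depth y, dir (diffs y)) : R * 'rV[R]_k.+1) @[y --> x] --> (depth x, dir (diffs x)).
    apply: (@cvg_couple _ _ _ (nbhs x)); first exact: depth_continuous.
    exact: (cvg_comp _ _ (@diffs_continuous x) (dir_continuous d0)).
  exact: (dc _ HB).
apply: filterS => y yB sy; apply: yB; split; first by rewrite /= in_itv; exact: depth01.
exact: dir_sphere.
Qed.

End cone_extension.

Lemma cone_extension (R : realType) (V : choiceType) (k : nat) (s : {fset V}) :
  #|` s| = k.+2 -> exists q : 'rV[R]_k.+1 -> prod_topology (fun _ : V => R),
  [/\ {within sphere R k, continuous q},
      forall z, sphere R k z -> cell_boundary s (q z) &
      forall (M : topologicalType) (f : prod_topology (fun _ : V => R) -> M) (A : set M),
        null_homotopic_in A (f \o q) ->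
        exists G : prod_topology (fun _ : V => R) -> M,
        [/\ {within cell s, continuous G},
          forall x, cell_boundary s x -> G x = f x &
          forall x, cell s x -> A (G x)]].
Proof.
move=> sk; have [w [vtx [idx [ws idxw vtxs vtxK idxP]]]] := fset_coordinates sk.
exact: (cone_extension_coordinates R ws idxw vtxs vtxK idxP sk).
Qed.

(** * Radius functions and fine covers *)
Section scales.
Variables (R : realType) (M : metricType R).
Implicit Types (rho : M -> R) (x y a b : M).

Definition lipschitz1 rho := forall x y, rho x <= rho y + mdist x y.

Section shrink.
Variable n : nat.

(** The contraction is measured against [rho] at the points of the set [A] in
    which it takes place, not at the centre [x]: the condition then passes to
    smaller balls with other centres, which makes [shrink] 1-Lipschitz.  The
    bound [r <= rho x] makes [shrink] decrease [rho]. *)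
Definition good_radii rho x : set R :=
  [set r | r <= rho x /\
    forall (i : nat) (f : 'rV[R]_i.+1 -> M), (i <= n)%N ->
      {within sphere R i, continuous f} ->
      (forall z, sphere R i z -> mdist x (f z) < r) ->
      exists2 A : set M, null_homotopic_in A f &
        forall a b, A a -> A b -> mdist a b <= rho a / 4].

Definition shrink rho x : R := sup (good_radii rho x).

Lemma good_radii_lipschitz rho x y r : lipschitz1 rho ->
  good_radii rho x r -> good_radii rho y (r - mdist x y).
Proof.
move=> lip [rx xr]; split.
  by rewrite lerBlDr; apply: le_trans rx (lip _ _).
move=> i f ni fc fy; apply: xr ni fc _ => z /fy fz.
by apply: le_lt_trans (metric_triangle _ y _) _; rewrite addrC -ltrBrDr.
Qed.

Hypothesis lc : LC R n M.
Variable rho : M -> R.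
Hypotheses (rho_gt0 : forall x, 0 < rho x) (rho_lip : lipschitz1 rho).

Lemma good_radii_pos x : exists2 r, 0 < r & good_radii rho x r.
Proof.
have e0 : 0 < rho x / 16 by rewrite divr_gt0.
(* on the ball of radius [rho x / 16] the function [rho] exceeds [rho x / 2],
   and two points of it are less than [rho x / 8] apart *)
have Ux : (ball x (rho x / 16))° x.
  by apply: nbhs_singleton; apply: nbhs_interior; exact: nbhsx_ballx.
have [W xW WP] := lc (open_interior _) Ux.
have [d /= d0 dW] := (nbhs_ballP x W).1 xW.
exists (Num.min d (rho x)); first by rewrite lt_min d0 rho_gt0.
split; first by rewrite ge_min lexx orbT.
move=> i f ni fc fx; exists (ball x (rho x / 16))°.
  apply: WP => // _ [z sz <-]; apply: dW.
  by rewrite ballEmdist /=; apply: lt_le_trans (fx z sz) _; rewrite ge_min lexx.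
move=> a b /interior_subset + /interior_subset; rewrite !ballEmdist /= => xa xb.
have := metric_triangle a x b; rewrite (metric_sym a x).
have := rho_lip x a; lra.
Qed.

Lemma good_radii_has_sup x : has_sup (good_radii rho x).
Proof.
by split; [have [r _ rg] := good_radii_pos x; exists r | exists (rho x) => r []].
Qed.

Lemma shrink_gt0 x : 0 < shrink rho x.
Proof.
have [r r0 rg] := good_radii_pos x; apply: lt_le_trans r0 _.
by apply: ub_le_sup rg; have [] := good_radii_has_sup x.
Qed.

Lemma shrink_le x : shrink rho x <= rho x.
Proof.
by apply: ge_sup; [have [] := good_radii_has_sup x | move=> r []].
Qed.

Lemma shrink_lipschitz : lipschitz1 (shrink rho).
Proof.
move=> x y; apply: ge_sup; first by have [] := good_radii_has_sup x.
move=> r /(good_radii_lipschitz y rho_lip) rg; rewrite -lerBlDr.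
by apply: ub_le_sup rg; have [] := good_radii_has_sup y.
Qed.

Lemma shrinkP x r (i : nat) (f : 'rV[R]_i.+1 -> M) :
  r < shrink rho x -> (i <= n)%N -> {within sphere R i, continuous f} ->
  (forall z, sphere R i z -> mdist x (f z) <= r) ->
  exists2 A : set M, null_homotopic_in A f &
    forall a b, A a -> A b -> mdist a b <= rho a / 4.
Proof.
move=> rx ni fc fr; have [_ ub] := good_radii_has_sup x.
have e0 : 0 < shrink rho x - r by rewrite subr_gt0.
have [r' [_ r'P]] := sup_adherent e0 (good_radii_has_sup x).
rewrite subKr => rr'; apply: r'P ni fc _ => z /fr fz; exact: le_lt_trans fz rr'.
Qed.

End shrink.

Lemma shrink_mono n rho rho' x : LC R n M ->
  (forall x, 0 < rho x) -> lipschitz1 rho ->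
  (forall x, 0 < rho' x) -> lipschitz1 rho' ->
  (forall x, rho x <= rho' x) -> shrink n rho x <= shrink n rho' x.
Proof.
move=> lc r0 lip r0' lip' le; apply: ge_sup; first by have [] := good_radii_has_sup lc r0 lip x.
move=> r [rx rP]; apply: ub_le_sup; first by have [] := good_radii_has_sup lc r0' lip' x.
split; first exact: le_trans rx (le _).
move=> i f ni fc fr; have [A fA Ad] := rP i f ni fc fr; exists A => // a b Aa Ab.
apply: le_trans (Ad a b Aa Ab) _.
by rewrite ler_pM2r ?invr_gt0.
Qed.

Section radius.
Variable n : nat.
Hypothesis lc : LC R n M.

Definition radius (k j : nat) : M -> R :=
  iter j (shrink n) (fun=> k.+1%:R^-1).

Lemma radius_gt0_lipschitz k j : (forall x, 0 < radius k j x) /\ lipschitz1 (radius k j).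
Proof.
elim: j => [|j [r0 lip]]; last first.
  by split; [exact: shrink_gt0 | exact: shrink_lipschitz].
by split=> [x|x y] /=; rewrite ?invr_gt0 // lerDl mdist_ge0.
Qed.

Lemma radius_gt0 k j x : 0 < radius k j x.
Proof. by have [] := radius_gt0_lipschitz k j. Qed.

Lemma radius_lipschitz k j : lipschitz1 (radius k j).
Proof. by have [] := radius_gt0_lipschitz k j. Qed.

Lemma radius_anti k k' j j' x : (k <= k')%N -> (j <= j')%N ->
  radius k' j' x <= radius k j x.
Proof.
move=> kk /subnK <-; elim: (j' - j)%N => [|i IH]; last first.
  apply: le_trans IH; rewrite addSn.
  exact: (shrink_le lc (@radius_gt0 _ _) (@radius_lipschitz _ _)).
rewrite add0n; elim: j x => [|j IH] x /=.
  by rewrite lef_pV2 ?posrE // ler_nat.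
apply: (shrink_mono x lc) => //; 
  [exact: radius_gt0 | exact: radius_lipschitz | exact: radius_gt0 | exact: radius_lipschitz].
Qed.

Lemma radius_le k j x : radius k j x <= k.+1%:R^-1.
Proof. exact: (@radius_anti k k 0 j x). Qed.

(** Members of the [k]-th and [(k+1)]-st cover that share a point have points
    at distance about two twelfths of the radius, less than the quarter with
    which the induction over skeleta starts. *)
Definition fine_cover (k : nat) : set (set M) :=
  [set W | open W /\ forall a b, W a -> W b -> mdist a b <= radius k n.+1 a / 12].

Lemma fine_cover_open k : open_cover (fine_cover k).
Proof.
split; first by move=> W [].
apply/seteqP; split=> // x _; set r := radius k n.+1.
have r0 : 0 < r x by exact: radius_gt0.
have lip : lipschitz1 r by exact: radius_lipschitz.
have Ux : (ball x (r x / 48))° x.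
  by apply: nbhs_singleton; apply: nbhs_interior; apply: nbhsx_ballx; rewrite divr_gt0.
exists (ball x (r x / 48))° => //; split; first exact: open_interior.
move=> a b /interior_subset + /interior_subset; rewrite !ballEmdist /= => xa xb.
have := metric_triangle a x b; rewrite (metric_sym a x).
change (mdist a b <= mdist x a + mdist x b -> mdist a b <= r a / 12); have := lip x a; lra.
Qed.

End radius.

Lemma diam_le (A : set M) (r : R) : 0 <= r ->
  (forall a b, A a -> A b -> mdist a b <= r) -> (diam A <= r%:E)%E.
Proof.
move=> r0 Ar; apply: ge_ereal_sup => _ [->|[[a b] [Aa Ab] <-]]; rewrite lee_fin //.
exact: Ar.
Qed.

Lemma mdist_le_diam (A : set M) a b : A a -> A b -> ((mdist a b)%:E <= diam A)%E.
Proof. by move=> Aa Ab; apply: ereal_sup_ubound; right; exists (a, b). Qed.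

Lemma diam_ge0 (A : set M) : (0 <= diam A)%E.
Proof. by apply: ereal_sup_ubound; left. Qed.

Lemma cvg_ereal_harmonic : ((k.+1%:R^-1 : R)%:E @[k --> \oo] --> (0 : \bar R))%E.
Proof. by apply: cvg_EFin; [exact: nearW | exact: cvg_harmonic]. Qed.

Lemma fine_cover_zero_sequence n : LC R n M -> zero_sequence (fine_cover n).
Proof.
move=> lc; split; first exact: fine_cover_open.
apply: (@squeeze_cvge _ _ _ _ (fun=> 0%E) _ (fun k => (k.+1%:R^-1 : R)%:E)).
- apply: nearW => k; apply/andP; split; first by apply: ereal_sup_ubound; left.
  apply: ge_ereal_sup => _ [->|[W [_ WP] <-]]; first by rewrite lee_fin invr_ge0.
  apply: diam_le; first by rewrite invr_ge0.
  move=> a b Wa Wb; apply: le_trans (WP a b Wa Wb) _.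
  apply: le_trans (radius_le lc k n.+1 a).
  have : 0 < radius n k n.+1 a by exact: radius_gt0.
  by move: (radius _ _ _ _) => r; lra.
- exact: cvg_cst.
- exact: cvg_ereal_harmonic.
Qed.

End scales.

(** * Extension over skeleta *)
Section skeleta.
Variables (R : realType) (V : choiceType).
Local Notation pt := (prod_topology (fun _ : V => R)).
Implicit Types (s t : {fset V}) (x y : pt).

Definition corner (v : V) : pt := fun u => (u == v)%:R.

Lemma corner_cell s v : v \in s -> cell s (corner v).
Proof.
move=> vs; split=> [u|u|]; first exact: ler0n.
  by rewrite /corner; case: eqVneq => // -> /negP.
rewrite (big_fsetD1 v) //= /corner eqxx big_seq big1 ?addr0 // => u.
by rewrite !inE => /andP[/negPf ->].
Qed.

Lemma cell1 v x : cell [fset v]%fset x -> x = corner v.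
Proof.
move=> [_ xs x1]; apply/funext => u; rewrite /corner.
have [->|uv] := eqVneq u v; last by apply: xs; rewrite inE.
by rewrite -x1 big_seq_fset1.
Qed.

Lemma cell_boundary_facet s x :
  cell_boundary s x <-> exists2 v, v \in s & cell (s `\ v)%fset x.
Proof.
split=> [[sx [v vs xv]]|[v vs vx]].
  exists v => //; apply: (cellW sx) => u; rewrite !inE negb_and negbK.
  by case/orP => [/eqP -> //|]; case: sx => _ xs _; exact: xs.
have [_ xs _] := vx; split; last by exists v => //; apply: xs; rewrite !inE eqxx.
by apply: (cellW vx) => u us; apply: xs; rewrite !inE (negPf us) andbF.
Qed.

(** The boundary is the union of finitely many facets, and a facet that misses a
    point also misses a neighbourhood of it: a coordinate which vanishes on
    the facet is nonzero there. *)
Lemma continuous_cell_boundary (M : topologicalType) (g : pt -> M) s :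
  (forall v, v \in s -> {within cell (s `\ v)%fset, continuous g}) ->
  {within cell_boundary s, continuous g}.
Proof.
move=> gc; apply/subspace_continuousP => x sx B gB.
have : \forall y \near x, forall v : s, cell (s `\ val v)%fset y -> B (g y).
  apply: (@filter_forall pt s _ (nbhs x)) => v.
  have [vx|vx] := pselect (cell (s `\ val v)%fset x).
    by move/subspace_continuousP : (gc _ (valP v)) => /(_ x vx B gB).
  have xv : x (val v) != 0.
    apply: contra_notN vx => /eqP xv; case: sx => sx _.
    apply: (cellW sx) => u; rewrite !inE negb_and negbK.
    by case/orP => [/eqP -> //|]; case: sx => _ xs _; exact: xs.
  have : \forall y \near x, y (val v) != 0.
    apply: (@ptws_coord_continuous R V (val v) x [set r | r != 0]).
    exact: (open_nbhs_nbhs (conj (@open_neq R 0) xv)).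
  apply: filterS => y yv [_ ys _]; case/eqP : yv; apply: ys.
  by rewrite !inE eqxx.
rewrite /within /=; apply: filterS => y yB /cell_boundary_facet [v vs vy].
exact: (yB [` vs]%fset).
Qed.

End skeleta.

Section skeleton_extension.
Variables (R : realType) (M : metricType R) (V : choiceType) (n : nat).
Local Notation pt := (prod_topology (fun _ : V => R)).
Implicit Types (s t : {fset V}) (x y : pt).
Hypothesis lc : LC R n M.
Variables (K : set {fset V}) (lev : {fset V} -> nat) (p : V -> M).
Hypothesis Kc : is_complex K.
Hypothesis lev_face : forall s t, K s -> K t -> (t `<=` s)%fset -> (lev s <= lev t)%N.
Hypothesis p_close : forall s u v, K s -> u \in s -> v \in s ->
  mdist (p u) (p v) <= radius n (lev s) n.+1 (p u) / 4.

(** The index [n.+1 - m] counts the dimensions that remain to be filled, and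
    each of them consumes one application of [shrink]. *)
Definition controlled (m : nat) (g : pt -> M) s :=
  {within cell s, continuous g} /\
  forall x y, cell s x -> cell s y ->
    mdist (g x) (g y) <= radius n (lev s) (n.+1 - m) (g x) / 4.

Definition extends_to (m : nat) (g : pt -> M) :=
  (forall v, g (corner R v) = p v) /\
  forall s, K s -> (#|` s| <= m.+1)%N -> controlled m g s.

Lemma face_complex s v : K s -> (1 < #|` s|)%N -> v \in s -> K (s `\ v)%fset.
Proof.
move=> Ks s1 vs; apply: (Kc Ks).2; last exact: fsubsetDl.
by rewrite -cardfs_gt0; have := cardfsD1 v s; rewrite vs; lia.
Qed.

Lemma vertex_extension (p0 : M) : exists g, extends_to 0 g.
Proof.
pose g x : M := if pselect (exists v, x = corner R v) is left e
  then p (sval (cid e)) else p0.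
have gE v : g (corner R v) = p v.
  rewrite /g; case: pselect => [e|[]]; last by exists v.
  case: cid => u /= /(congr1 (fun h => h v)) /eqP.
  by rewrite /corner eqxx; have [->|_] := eqVneq v u; rewrite ?eqxx ?oner_eq0.
exists g; split => // s Ks s1.
have /cardfs1P [v sv] : #|` s| == 1%N.
  by rewrite eqn_leq s1 cardfs_gt0 (Kc Ks).1.
have cE x : cell s x -> x = corner R v by rewrite sv; exact: cell1.
split=> [|x y /cE -> /cE ->]; last by rewrite mdistxx divr_ge0 // ltW // radius_gt0.
apply/subspace_continuousP => x sx.
apply: (@cvg_near_eq _ _ (within (cell s) (nbhs x)) _ (fun=> g x)); last exact: cvg_cst.
by rewrite near_withinE; apply: nearW => y /cE ->; rewrite (cE _ sx).
Qed.

(** Each facet has diameter at most a quarter of the radius, and all vertices are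
    within a quarter of the radius of each other, so the Lipschitz condition
    puts the whole boundary within [9/16] of the radius at any vertex.  Facets
    may have a higher level than the cell, but radii decrease with the level. *)
Lemma cell_filling (m : nat) (g : pt -> M) s : (m <= n)%N -> extends_to m g ->
  K s -> #|` s| = m.+2 ->
  exists G : pt -> M, [/\ {within cell s, continuous G},
    forall x, cell_boundary s x -> G x = g x &
    forall x y, cell s x -> cell s y ->
      mdist (G x) (G y) <= radius n (lev s) (n - m) (G x) / 4].
Proof.
move=> mn [gv gs] Ks sm.
have [q [qc qb qext]] := cone_extension R sm.
have facet v : v \in s -> K (s `\ v)%fset /\ #|` (s `\ v)%fset| = m.+1.
  move=> vs; split; first by apply: face_complex => //; rewrite sm.
  by have := cardfsD1 v s; rewrite vs sm add1n => -[->].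
have ctrl v : v \in s -> controlled m g (s `\ v)%fset.
  by move=> /facet [Kv cv]; apply: gs => //; rewrite cv.
have gb : {within cell_boundary s, continuous g}.
  by apply: continuous_cell_boundary => v /ctrl [].
have [u us] : exists u, u \in s by apply/fset0Pn; rewrite -cardfs_gt0 sm.
pose rho : M -> R := radius n (lev s) (n - m).+1.
have rhoE : (n.+1 - m = (n - m).+1)%N by rewrite subSn.
have fc : {within sphere R m, continuous (g \o q)}.
  apply/subspace_continuousP => z sz.
  move/subspace_continuousP : gb => gb; move/subspace_continuousP : qc => qc.
  apply: cvg_comp (gb (q z) (qb z sz)) => B; rewrite /within /= => HB.
  have := qc z sz _ HB; rewrite /nbhs /= /within /=.
  by apply: (@filterS _ (nbhs z)) => y yB sy; apply: yB => //; exact: qb.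
have fr z : sphere R m z -> mdist (p u) ((g \o q) z) <= 9 / 16 * rho (p u).
  move=> /qb /cell_boundary_facet [v vs vz] /=.
  have [Kv cv] := facet v vs; have [_ gd] := ctrl v vs.
  have [u' u's] : exists u', u' \in (s `\ v)%fset.
    by apply/fset0Pn; rewrite -cardfs_gt0 cv.
  have us' : u' \in s by move: u's; rewrite !inE => /andP[].
  have := gd _ _ (corner_cell R u's) vz; rewrite gv rhoE => d1.
  have d2 := p_close Ks us us'.
  have le1 : radius n (lev s) n.+1 (p u) <= rho (p u).
    by apply: radius_anti => //; lia.
  have le2 : radius n (lev (s `\ v)%fset) (n - m).+1 (p u') <= rho (p u').
    by apply: radius_anti => //; apply: lev_face => //; exact: fsubsetDl.
  have lip : rho (p u') <= rho (p u) + mdist (p u') (p u) by exact: radius_lipschitz.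
  have tri := metric_triangle (p u) (p u') (g (q z)).
  rewrite (metric_sym (p u')) in lip.
  move: d1 d2 le1 le2 lip tri.
  move: (rho (p u)) (rho (p u')) (radius _ _ _ _) (radius _ _ _ _) => a b c d.
  move: (mdist _ _) (mdist _ _) (mdist _ _) => e f h; lra.
have rp : 9 / 16 * rho (p u) < rho (p u).
  have : 0 < rho (p u) by exact: radius_gt0.
  by move: (rho (p u)) => r; lra.
have [A fA Ad] := shrinkP lc (@radius_gt0 _ _ _ lc (lev s) (n - m))
  (@radius_lipschitz _ _ _ lc (lev s) (n - m)) rp mn fc fr.
have [G [Gc Gb GA]] := qext M g A fA.
by exists G; split => // x y sx sy; apply: Ad; exact: GA.
Qed.

(** The fillings agree with the old map on boundaries, and two different cells of
    the same dimension meet in points of lower cells, so the fillings combine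
    with the old map into one function. *)
Lemma skeleton_extension (p0 : M) (m : nat) : (m <= n.+1)%N ->
  exists g, extends_to m g.
Proof.
elim: m => [|m IH] mn; first exact: vertex_extension.
have [g gm] := IH (ltnW mn); have {}mn : (m <= n)%N by [].
have fill s : exists G : pt -> M, K s -> #|` s| = m.+2 ->
    [/\ {within cell s, continuous G},
      forall x, cell_boundary s x -> G x = g x &
      forall x y, cell s x -> cell s y ->
        mdist (G x) (G y) <= radius n (lev s) (n - m) (G x) / 4].
  have [[Ks sm]|nK] := pselect (K s /\ #|` s| = m.+2); last first.
    by exists g => Ks sm; case: nK.
  by have [G GP] := cell_filling mn gm Ks sm; exists G.
have [G GP] := choice fill.
pose low x := exists s, [/\ K s, (#|` s| <= m.+1)%N & cell s x].
pose top x s := [/\ K s, #|` s| = m.+2 & cell s x].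
pose g' x := if pselect (low x) then g x else
  if pselect (exists s, top x s) is left e then G (sval (cid e)) x else g x.
have g'low s x : K s -> (#|` s| <= m.+1)%N -> cell s x -> g' x = g x.
  by move=> Ks sm sx; rewrite /g'; case: pselect => // -[]; exists s.
have g'top s x : K s -> #|` s| = m.+2 -> cell s x -> g' x = G s x.
  move=> Ks sm sx; have [_ Gb _] := GP s Ks sm.
  have drop t : cell t x -> ~ (s `<=` t)%fset -> cell_boundary s x.
    move=> [_ tx _] /negP /fsubsetPn [v vs vt]; split => //.
    by exists v => //; exact: tx.
  rewrite /g'; case: pselect => [[t [Kt tm tx]]|nlow].
    apply/esym/Gb/(drop t tx) => /fsubset_leq_card.
    by rewrite sm leqNgt ltnS tm.
  case: pselect => [e|[]]; last by exists s.
  case: cid => t /= [Kt tm tx]; have [-> //|st] := eqVneq t s.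
  case: nlow; have /cell_boundary_facet [v vs vx] : cell_boundary s x.
    apply: drop tx _ => ss; move/eqP : st; apply; apply/esym/eqP.
    by rewrite eqEfcard ss sm tm leqnn.
  exists (s `\ v)%fset; split => //; first by apply: face_complex; rewrite ?sm.
  by have := cardfsD1 v s; rewrite vs sm add1n => -[<-].
exists g'; split=> [v|s Ks].
  rewrite /g'; case: pselect => [?|nlow]; first exact: gm.1.
  case: pselect => [e|?]; last exact: gm.1.
  case: nlow; case: e => t [Kt _ [_ xt _]]; exists [fset v]%fset; split.
  - apply: (Kc Kt).2; first by apply/fset0Pn; exists v; rewrite inE.
    rewrite fsub1set; apply: contraT => /xt /eqP.
    by rewrite /corner eqxx oner_eq0.
  - by rewrite cardfs1.
  - by apply: corner_cell; rewrite inE.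
rewrite leq_eqVlt => /orP[/eqP sm|sm].
  have [Gc Gb Gd] := GP s Ks sm; split.
    apply: subspace_eq_continuous Gc => x; rewrite inE => sx.
    by rewrite /from_subspace (g'top s).
  by move=> x y sx sy; rewrite !(g'top s) // subSS; exact: Gd.
have [_ /(_ s Ks sm) [gc gd]] := gm; split.
  apply: subspace_eq_continuous gc => x; rewrite inE => sx.
  by rewrite /from_subspace (g'low s).
move=> x y sx sy; rewrite !(g'low s) //; apply: le_trans (gd x y sx sy) _.
by rewrite ler_pM2r ?invr_gt0 //; apply: radius_anti => //; lia.
Qed.

End skeleton_extension.

(** * Telescopes and maps defined on realizations *)
Section telescopes.
Variables (M : Type) (U : nat -> set (set M)).
Implicit Types s t : {fset nat * set M}.

Lemma nerve_pair_face k s t : nerve_pair U k s -> t != fset0 ->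
  (t `<=` s)%fset -> nerve_pair U k t.
Proof.
move=> [_ sU [c cs]] t0 /fsubsetP ts; split => //.
  by move=> v /= vt; apply: sU; exact: ts.
by exists c => v /= vt; apply: cs; exact: ts.
Qed.

Lemma Tel_complex : is_complex (Tel U).
Proof.
move=> s [k _ ks]; split; first by case: ks.
by move=> t t0 ts; exists k => //; exact: nerve_pair_face ks t0 ts.
Qed.

Lemma nerve_pair_vertex k s v : nerve_pair U k s -> v \in s ->
  (k <= v.1 <= k.+1)%N /\ U v.1 v.2.
Proof.
by move=> [_ sU _] /sU [] [-> Uv]; rewrite leqnn leqnSn.
Qed.

Lemma level_spec s : Tel U s ->
  nerve_pair U (level U s) s /\
  forall l, nerve_pair U l s -> (l <= level U s)%N.
Proof.
move=> [k _ ks]; have [/fset0Pn [v vs] _ _] := ks.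
have exk : exists k, `[< nerve_pair U k s >] by exists k; apply/asboolP.
have ub l : `[< nerve_pair U l s >] -> (l <= v.1)%N.
  by move=> /asboolP ls; have [/andP[]] := nerve_pair_vertex ls vs.
suff : [set k | nerve_pair U k s /\ forall l, nerve_pair U l s -> (l <= k)%N] (level U s).
  by [].
rewrite /level; apply: xgetPex.
have [m /asboolP ms mmax] := ex_maxnP exk ub; exists m; split => // l ls.
by apply: mmax; apply/asboolP.
Qed.

Lemma level_face s t : Tel U s -> t != fset0 -> (t `<=` s)%fset ->
  (level U s <= level U t)%N.
Proof.
move=> Us t0 ts; have [sl _] := level_spec Us.
have tl := nerve_pair_face sl t0 ts.
by apply: (level_spec _).2 => //; exists (level U s).
Qed.

End telescopes.

Section realizations.
Variables (R : realType) (V : choiceType).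
Implicit Types (K : set {fset V}) (s : {fset V}).

Lemma realization_eq K (x y : realization R K) : bary x =1 bary y -> x = y.
Proof.
case: x y => [f f0 fs] [g g0 gs] /= /funext fg; subst g.
by rewrite (Prop_irrelevance f0 g0) (Prop_irrelevance fs gs).
Qed.

Lemma closed_simplex_cell K s (x : realization R K) :
  closed_simplex s x -> cell s (bary x).
Proof.
move=> sx; have [t Kt [xt x1]] := bary_simplex x.
have tx : cell t (bary x) by split => //; exact: bary_ge0.
exact: cellW tx sx.
Qed.

Lemma bary_cell K (x : realization R K) : exists2 s, K s & cell s (bary x).
Proof.
have [t Kt [xt x1]] := bary_simplex x.
by exists t => //; split => //; exact: bary_ge0.
Qed.

Lemma skeleton0_vertex K (x : realization R (skeleton 0 K)) : is_complex K ->
  exists v (Kv : skeleton 0 K [fset v]%fset), x = vertex R Kv.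
Proof.
move=> Kc; have [s Ks sx] := bary_cell x; have [Ks' s1] := Ks.
have /cardfs1P [v sv] : #|` s| == 1%N.
  by rewrite eqn_leq s1 cardfs_gt0 (Kc _ Ks').1.
rewrite sv in Ks sx; exists v, Ks; apply: realization_eq => u.
by rewrite (cell1 sx).
Qed.

Lemma skeleton_vertex m K s : is_complex K -> skeleton m K s ->
  exists v, skeleton 0 K [fset v]%fset.
Proof.
move=> Kc [Ks _]; have [/fset0Pn [v vs] Kt] := Kc s Ks.
exists v; split; last by rewrite cardfs1.
by apply: Kt; rewrite ?fsub1set // -cardfs_gt0 cardfs1.
Qed.

(** Compatibility of the Whitehead topology with the cell by cell description
    of continuity used for skeleta. *)
Lemma realization_continuous (M : topologicalType) K
    (g : prod_topology (fun _ : V => R) -> M) :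
  (forall s, K s -> {within cell s, continuous g}) ->
  continuous (fun x : realization R K => g (bary x)).
Proof.
move=> gc; apply/continuousP => A Ao.
suff : @realization_open R V K ((fun x : realization R K => g (bary x)) @^-1` A) by [].
move=> s Ks; have := gc s Ks; move=> /continuousP /(_ A Ao) /open_subspaceP [Q Qo QA].
exists Q => //; apply/seteqP; split=> x [xA sx]; split => //.
  have : (Q `&` cell s) (bary x) by rewrite QA; split => //; exact: closed_simplex_cell.
  by case.
have : (g @^-1` A `&` cell s) (bary x) by rewrite -QA; split => //; exact: closed_simplex_cell.
by case.
Qed.

End realizations.

(** An empty [M] is treated apart because the functions on cells take values in [M]
    outside the complex as well; the complex [K] is then empty too. *)
Theorem LC_extension (R : realType) (n : nat) (M : metricType R) :
  LC R n M ->
  forall K : set {fset nat * set M}, subcomplex K (Tel (fine_cover n)) ->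
    forall f0 : realization R (skeleton 0 K) -> M,
    (forall (v : nat * set M) (Kv : skeleton 0 K [fset v]%fset),
        v.2 (f0 (vertex R Kv))) ->
    exists f : realization R (skeleton n.+1 K) -> M,
      [/\ continuous f,
          forall x, f (realization_incl (skeletonS (leq0n n.+1)) x) = f0 x &
          forall sigma : nat -> {fset nat * set M},
            (forall k, skeleton n.+1 K (sigma k)) ->
            level (fine_cover n) (sigma k) @[k --> \oo] --> \oo ->
            diam (f @` closed_simplex (sigma k)) @[k --> \oo] --> (0 : \bar R)%E].
Proof.
move=> lc K [Kc KT] f0 f0U; set U := fine_cover n.
have [[p0 _]|noM] := pselect (exists p : M, True); last first.
  have noK s : ~ skeleton n.+1 K s.
    by move=> /(skeleton_vertex Kc) [v Kv]; apply: noM; exists (f0 (vertex R Kv)).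
  have noX (x : realization R (skeleton n.+1 K)) : False.
    by have [s /noK] := bary_cell x.
  exists (fun x => match noX x with end); split=> [x|x|sigma /(_ 0%N) /noK //].
    by case: (noX x).
  by case: (noX (realization_incl (skeletonS (leq0n n.+1)) x)).
pose p v : M := if pselect (skeleton 0 K [fset v]%fset) is left Kv
  then f0 (vertex R Kv) else p0.
have pE v (Kv : skeleton 0 K [fset v]%fset) : p v = f0 (vertex R Kv).
  by rewrite /p; case: pselect => // Kv'; rewrite (Prop_irrelevance Kv' Kv).
have pU s v : K s -> v \in s -> v.2 (p v).
  move=> Ks vs; have Kv : skeleton 0 K [fset v]%fset.
    split; last by rewrite cardfs1.
    by apply: (Kc _ Ks).2; rewrite ?fsub1set // -cardfs_gt0 cardfs1.
  by rewrite (pE v Kv).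
have lev_face s t : K s -> K t -> (t `<=` s)%fset -> (level U s <= level U t)%N.
  by move=> Ks Kt; apply: level_face; [exact: KT | have [] := Kc t Kt].
have p_close s u v : K s -> u \in s -> v \in s ->
    mdist (p u) (p v) <= radius n (level U s) n.+1 (p u) / 4.
  move=> Ks us vs; have [ls _] := level_spec (KT _ Ks); have [_ _ [c cs]] := ls.
  set r := radius n (level U s) n.+1.
  have small w a b : w \in s -> w.2 a -> w.2 b -> mdist a b <= r a / 12.
    move=> ws wa wb; have [/andP[lw _] [_ Uw]] := nerve_pair_vertex ls ws.
    apply: le_trans (Uw a b wa wb) _; rewrite ler_pM2r ?invr_gt0 //.
    exact: radius_anti.
  have d1 := small u (p u) c us (pU s u Ks us) (cs u us).
  have d2 := small v c (p v) vs (cs v vs) (pU s v Ks vs).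
  have lip : r c <= r (p u) + mdist c (p u) by exact: radius_lipschitz.
  rewrite (metric_sym c) in lip.
  have := metric_triangle (p u) c (p v).
  have ru : 0 < r (p u) by exact: radius_gt0.
  move: ru d1 d2 lip; move: (r c) (r (p u)) => a b; lra.
have [g [gv gs]] := skeleton_extension lc Kc lev_face p_close p0 (leqnn n.+1).
exists (fun x => g (bary x)); split.
- apply: realization_continuous => s [Ks cs].
  by have [] := gs s Ks cs.
- move=> x; have [v [Kv ->]] := skeleton0_vertex x Kc.
  by rewrite -pE -gv.
move=> sigma Ks sl.
apply: (@squeeze_cvge _ _ _ _ (fun=> 0%E) _
  (fun k => ((level U (sigma k)).+1%:R^-1 : R)%:E)); last 2 first.
- exact: cvg_cst.
- exact: (cvg_comp _ _ sl (@cvg_ereal_harmonic R)).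
apply: nearW => k; rewrite diam_ge0 /=; apply: diam_le; first by rewrite invr_ge0.
move=> _ _ [x sx <-] [y sy <-]; have [Kk ck] := Ks k.
have [_ gd] := gs _ Kk ck.
apply: le_trans (gd _ _ (closed_simplex_cell sx) (closed_simplex_cell sy)) _.
apply: le_trans (radius_le lc (level U (sigma k)) (n.+1 - n.+1) (g x)).
have : 0 < radius n (level U (sigma k)) (n.+1 - n.+1) (g x) by exact: radius_gt0.
by move: (radius _ _ _ _) => r; lra.
Qed.

(** * Maps into realizations from partitions of unity *)
Section maps_into_realizations.
Variables (R : realType) (V : choiceType) (K : set {fset V}).
Hypothesis Kc : is_complex K.

Lemma skeleton_complex m : is_complex (skeleton m K).
Proof.
move=> s [Ks sm]; have [s0 face] := Kc Ks; split => // t t0 ts.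
split; first exact: face.
exact: leq_trans (fsubset_leq_card ts) sm.
Qed.

(** Locally only finitely many simplexes carry values of [phi].  Those that do
    not carry [phi x] are left out of a neighbourhood of [x], and on each of
    the others the Whitehead topology is that of coordinatewise convergence. *)
Lemma continuous_to_realization (X : topologicalType) (phi : X -> realization R K) :
  (forall v, continuous (fun x => phi x v)) ->
  (forall x : X, exists F : {fset V}, \forall y \near x, forall v, v \notin F -> phi y v = 0) ->
  continuous phi.
Proof.
move=> phic phif x A /=; rewrite nbhsE => -[B [Bo Bx] BA].
suff : \forall y \near x, B (phi y).
  by apply: (@filterS _ (nbhs x)) => y; exact: BA.
have {}Bo : @realization_open R V K B by [].
have [F xF] := phif x.
have : \forall y \near x, forall s : fpowerset F,
    K (val s) -> closed_simplex (val s) (phi y) -> B (phi y).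
  apply: (@filter_forall _ _ _ (nbhs x)) => -[s sF] /=.
  have [Ks|nKs] := pselect (K s); last by apply: nearW => y /nKs.
  have [Q Qo QB] := Bo s Ks.
  have [sx|sx] := pselect (closed_simplex s (phi x)); last first.
    have [v] : exists v, ~ (v \notin s -> phi x v = 0) by apply/existsNP.
    move=> /not_implyP [vs /eqP xv].
    have : \forall y \near x, phi y v != 0.
      apply: (phic v x [set r | r != 0]).
      exact: (open_nbhs_nbhs (conj (@open_neq R 0) xv)).
    by apply: filterS => y /eqP yv _ /(_ v vs).
  have Qx : Q (bary (phi x)).
    by have : (B `&` closed_simplex s) (phi x) by []; rewrite QB => -[].
  have bc : (bary (phi y) : prod_topology (fun _ : V => R)) @[y --> x] -->
      (bary (phi x) : prod_topology (fun _ : V => R)).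
    by apply: (@cvg_ptws _ _ _ (nbhs x)) => v; exact: phic.
  apply: (@filterS _ (nbhs x) _ _ _ _ (bc _ (open_nbhs_nbhs (conj Qo Qx)))) => y Qy _ sy.
  by have : ((@bary R V K) @^-1` Q `&` closed_simplex s) (phi y) by []; rewrite -QB => -[].
apply: filterS2 xF => y yF yB.
have [t Kt [yt y1]] := bary_simplex (phi y).
have tF : (t `&` F)%fset \in fpowerset F by rewrite fpowersetE fsubsetIr.
have ytF : forall v, v \notin (t `&` F)%fset -> phi y v = 0.
  by move=> v; rewrite inE negb_and => /orP[/yt|/yF].
apply: (yB [` tF]%fset) => //=; apply: (Kc Kt).2; last exact: fsubsetIl.
apply/eqP => tF0; have := y1; rewrite (sum_fset_support yt ytF) tF0.
by rewrite big_seq_fset0 => /eqP; rewrite eq_sym oner_eq0.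
Qed.

Variables (X : topologicalType) (I : choiceType) (lam : I -> X -> R) (omega : I -> V).
Hypothesis lam_ge0 : forall i x, 0 <= lam i x.
Hypothesis lam_continuous : forall i, continuous (lam i).
Hypothesis lam_finite : forall x : X, exists F : {fset I},
  \forall y \near x, forall i, i \notin F -> lam i y = 0.
Hypothesis lam_cover : forall x, exists i, 0 < lam i x.
Hypothesis lam_simplex : forall x (s : {fset I}),
  (forall i, i \in s = (0 < lam i x)) -> K (omega @` s)%fset.

Lemma active_fset x : exists s : {fset I}, forall i, i \in s = (0 < lam i x).
Proof.
have [F /nbhs_singleton xF] := lam_finite x.
exists [fset i in F | 0 < lam i x]%fset => i; rewrite !inE /=.
by have [//|iF] := boolP (i \in F); rewrite xF ?ltxx.
Qed.

Let weight x (F : {fset I}) (v : V) : R :=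
  \sum_(i <- F) (if omega i == v then lam i x else 0).
Let total x (F : {fset I}) : R := \sum_(i <- F) lam i x.

(** The functions [lam] need not sum to one; their sum is locally finite and
    positive, and is divided out.  A vertex receives the total weight of the
    indices that [omega] sends to it. *)
Lemma partition_map : exists phi : X -> realization R K,
  continuous phi /\
  forall x v, phi x v != 0 -> exists2 i, omega i = v & 0 < lam i x.
Proof.
have [act actP] := choice active_fset.
have lam0 x (F : {fset I}) i : (forall j, 0 < lam j x -> j \in F) -> i \notin F -> lam i x = 0.
  move=> xF iF; apply/eqP; rewrite eq_le lam_ge0 andbT leNgt.
  by apply: contra iF; exact: xF.
have act0 x i : i \notin act x -> lam i x = 0.
  by apply: lam0 => j; rewrite actP.
have totalE x (F : {fset I}) : (forall i, i \notin F -> lam i x = 0) ->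
    total x (act x) = total x F.
  by move=> xF; apply: sum_fset_support => // i; exact: act0.
have weightE x (F : {fset I}) v : (forall i, i \notin F -> lam i x = 0) ->
    weight x (act x) v = weight x F v.
  move=> xF; apply: sum_fset_support => i iF; case: ifP => // _; last exact: xF.
  exact: act0.
have total_gt0 x : 0 < total x (act x).
  have [i ix] := lam_cover x; rewrite /total (big_fsetD1 i) ?actP //=.
  by rewrite ltr_pwDl // sumr_ge0.
pose b x v := weight x (act x) v / total x (act x).
have b_ge0 x v : 0 <= b x v.
  apply: divr_ge0; last exact: ltW.
  by apply: sumr_ge0 => i _; case: ifP.
have b_supp x v : b x v != 0 -> exists2 i, omega i = v & 0 < lam i x.
  apply: contra_neqP => nv; rewrite /b /weight big_seq big1 ?mul0r // => i.
  by rewrite actP => ix; case: eqP => // iv; case: nv; exists i.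
have b_simplex x : exists2 s, K s & (forall v, v \notin s -> b x v = 0) /\
    \sum_(v <- s) b x v = 1.
  exists (omega @` act x)%fset; first by apply: (@lam_simplex x) => i; rewrite actP.
  split=> [v vs|].
    apply/eqP; apply: contraNT vs => /b_supp [i <- ix].
    by apply: in_imfset; rewrite /= actP.
  rewrite -mulr_suml /weight exchange_big /=.
  rewrite -[RHS](divff (lt0r_neq0 (total_gt0 x))); congr (_ / _).
  rewrite /total big_seq [RHS]big_seq; apply: eq_bigr => i ix.
  rewrite (big_fsetD1 (omega i)) /= ?in_imfset // eqxx big_seq big1 ?addr0 // => v.
  by rewrite !inE => /andP[vi _]; rewrite eq_sym (negPf vi).
exists (fun x => Realization (b_ge0 x) (b_simplex x)); split; last exact: b_supp.
apply: continuous_to_realization => [v x|x] /=; have [F xF] := lam_finite x.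
  have [xF' eF] : (forall i, i \notin F -> lam i x = 0) /\
     \forall y \near x, weight y F v / total y F = b y v.
    split; first exact: (nbhs_singleton xF).
    by apply: filterS xF => y yF; rewrite /b (weightE y F v yF) (totalE y F yF).
  apply: (@cvg_near_eq _ _ (nbhs x) _ _ _ _ eF).
  rewrite /b (weightE x F v xF') (totalE x F xF').
  apply: cvgM.
    apply: cvg_bigsum => i; case: ifP => _; last exact: cvg_cst.
    exact: lam_continuous.
  apply: cvgV; first by rewrite -(totalE x F xF') lt0r_neq0.
  by apply: cvg_bigsum => i; exact: lam_continuous.
exists (omega @` F)%fset; apply: filterS xF => y yF v vF.
apply/eqP; apply: contraNT vF => /b_supp [i <- iy]; apply: in_imfset => /=.
by apply: contraLR iy => /yF ->; rewrite ltxx.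
Qed.

End maps_into_realizations.

(** * The cover of Euclidean space by lattice stars *)
Section lattice.
Variables (R : realType) (m : nat).
Implicit Types (x : 'rV[R]_m) (v w : 'rV[int]_m).

Definition above v x : R := \big[Num.max/0]_i (x ord0 i - (v ord0 i)%:~R).
Definition below v x : R := \big[Num.max/0]_i ((v ord0 i)%:~R - x ord0 i).
(** The piecewise linear function of the Freudenthal triangulation that is [1] at
    the lattice point [v] and [0] at all others: it is positive at [x] when the
    coordinates of [x - v], together with [0], spread over less than [1]. *)
Definition hat v x : R := Num.max 0 (1 - (above v x + below v x)).

Lemma hat_ge0 v x : 0 <= hat v x.
Proof. by rewrite /hat le_max lexx. Qed.

Lemma hat_gt0 v x : (0 < hat v x) = (above v x + below v x < 1).
Proof. by rewrite /hat lt_max ltxx subr_gt0. Qed.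

Lemma hat_continuous v : continuous (hat v).
Proof.
have maxc : continuous (fun p : R * R => Num.max p.1 p.2).
  by move=> p; apply: (@continuous_max R (R * R)%type fst snd); [exact: cvg_fst|exact: cvg_snd].
move=> x; rewrite /hat.
apply: (@continuous_max R 'rV[R]_m (fun=> 0) (fun x => 1 - (above v x + below v x))).
  exact: (@cvg_cst R 0 _ (nbhs x) _).
apply: (@cvgB _ _ _ (nbhs x)); first exact: (@cvg_cst R 1 _ (nbhs x) _).
apply: (@cvgD _ _ _ (nbhs x)); apply: (@cvg_big _ _ _ _ _ maxc _ (nbhs x)) => i _.
  apply: (@cvgB _ _ _ (nbhs x)); last exact: (@cvg_cst R _ _ (nbhs x) _).
  exact: (@coord_continuous R 1 m ord0 i x).
apply: (@cvgB _ _ _ (nbhs x)); first exact: (@cvg_cst R _ _ (nbhs x) _).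
exact: (@coord_continuous R 1 m ord0 i x).
Qed.

Lemma above_ge v x i : x ord0 i - (v ord0 i)%:~R <= above v x.
Proof. exact: (le_bigmax 0 (fun i => x ord0 i - (v ord0 i)%:~R) i). Qed.

Lemma below_ge v x i : (v ord0 i)%:~R - x ord0 i <= below v x.
Proof. exact: (le_bigmax 0 (fun i => (v ord0 i)%:~R - x ord0 i) i). Qed.

Lemma above_ge0 v x : 0 <= above v x.
Proof. exact: bigmax_ge_id. Qed.

Lemma below_ge0 v x : 0 <= below v x.
Proof. exact: bigmax_ge_id. Qed.

Lemma hat_near v x i : 0 < hat v x -> `|x ord0 i - (v ord0 i)%:~R| < 1.
Proof.
rewrite hat_gt0 ltr_norml => vx.
have := above_ge v x i; have := below_ge v x i.
have := above_ge0 v x; have := below_ge0 v x; lra.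
Qed.

Lemma hat_step v w x i j : 0 < hat v x -> 0 < hat w x ->
  w ord0 i - v ord0 i <= 1 /\
  (w ord0 i - v ord0 i) - (w ord0 j - v ord0 j) <= 1.
Proof.
rewrite !hat_gt0 => vx wx.
have lt2 (z : int) : z%:~R < 2 :> R -> z <= 1.
  by rewrite -[2 : R]/(2%:~R) ltr_int; lia.
have [vi vj wi wj] : [/\ x ord0 i - (v ord0 i)%:~R <= above v x,
   (v ord0 j)%:~R - x ord0 j <= below v x, (w ord0 i)%:~R - x ord0 i <= below w x &
   x ord0 j - (w ord0 j)%:~R <= above w x].
  by rewrite !above_ge !below_ge.
have [v0 w0 v1 w1] : [/\ 0 <= above v x, 0 <= below w x, 0 <= below v x & 0 <= above w x].
  by rewrite !above_ge0 !below_ge0.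
by split; apply: lt2; rewrite !rmorphB /=; lra.
Qed.

(** If two stars contain [x], the coordinates of the difference of their centres
    are integers that differ from [0] and from each other by less than [2].
    So they are all in [0, 1] or all in [-1, 0]. *)
Lemma hat_chain v w x : 0 < hat v x -> 0 < hat w x ->
  (forall i, 0 <= w ord0 i - v ord0 i <= 1) \/
  (forall i, 0 <= v ord0 i - w ord0 i <= 1).
Proof.
move=> vx wx; have [up|] := pselect (forall i, v ord0 i <= w ord0 i).
  by left=> i; have [] := hat_step i i vx wx; have := up i; lia.
move=> /existsNP [j wj]; right=> i.
have [_] := hat_step i j vx wx; have [] := hat_step i i wx vx.
by move: wj; lia.
Qed.

Lemma hat_cover x : exists v, 0 < hat v x.
Proof.
exists (\row_i Num.floor (x ord0 i)); rewrite hat_gt0.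
have fl i := floor_itv (x ord0 i).
rewrite [below _ _]bigmax_eq_id ?addr0.
  apply: bigmax_lt => // i _; rewrite mxE.
  by have := fl i; rewrite rmorphD /=; lra.
by move=> i _; rewrite mxE; have := fl i; lra.
Qed.

Lemma hat_finite x : exists F : {fset 'rV[int]_m},
  \forall y \near x, forall v, v \notin F -> hat v y = 0.
Proof.
pose box (g : {ffun 'I_m -> 'I_7}) : 'rV[int]_m :=
  \row_i (Num.floor (x ord0 i) + (g i : nat)%:Z - 3).
exists [fset v in [seq box g | g <- enum {ffun 'I_m -> 'I_7}]]%fset.
have : \forall y \near x, `|x - y| < 1.
  by apply/nbhs_ballP; exists 1 => //= y; rewrite -ball_normE.
apply: (@filterS _ (nbhs x)) => y xy v vF; apply/eqP; apply: contraNT vF => hv.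
have {}hv : 0 < hat v y by rewrite lt_neqAle eq_sym hv hat_ge0.
have vi i : -3 <= v ord0 i - Num.floor (x ord0 i) <= 3.
  have := hat_near i hv; rewrite ltr_norml => /andP[h1 h2].
  have : `|x ord0 i - y ord0 i| < 1.
    apply: le_lt_trans xy; rewrite [X in _ <= X]mx_normrE.
    have := @le_bigmax _ _ _ 0 (fun ij : 'I_1 * 'I_m => `|(x - y) ij.1 ij.2|) (ord0, i).
    by rewrite !mxE.
  rewrite ltr_norml => /andP[h3 h4].
  have := floor_itv (x ord0 i); rewrite rmorphD /= => /andP[h5 h6].
  have le3 (z : int) : z%:~R < 4 :> R -> z <= 3.
    by rewrite -[4 : R]/(4%:~R) ltr_int; lia.
  have d1 : v ord0 i - Num.floor (x ord0 i) <= 3 by apply: le3; rewrite rmorphB /=; lra.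
  have d2 : Num.floor (x ord0 i) - v ord0 i <= 3 by apply: le3; rewrite rmorphB /=; lra.
  by move: d1 d2; lia.
rewrite inE /=; apply/mapP.
exists [ffun i => inord (absz (v ord0 i - Num.floor (x ord0 i) + 3))].
  by rewrite mem_enum.
apply/rowP => i; have := vi i; rewrite mxE ffunE !(ord1 ord0).
by move: (v _ _) (Num.floor _) => a b ab; rewrite inordK; lia.
Qed.

(** By [hat_chain] the centres of the stars through [x] form a chain, along which
    the sum of the coordinates strictly increases, by at most [m] in total.
    This sum modulo [m.+1] therefore tells the centres apart. *)
Lemma card_hat x (s : {fset 'rV[int]_m}) :
  (forall v, v \in s -> 0 < hat v x) -> (#|` s| <= m.+1)%N.
Proof.
move=> sx; pose c v : 'I_m.+1 := inord (absz ((\sum_i v ord0 i) %% m.+1)%Z).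
have cinj : {in s &, injective c}.
  move=> v w /sx vx /sx wx.
  have inj_le v' w' : (forall i, 0 <= w' ord0 i - v' ord0 i <= 1) -> c v' = c w' -> v' = w'.
    move=> vw cvw.
    have sumE : \sum_i w' ord0 i = \sum_i v' ord0 i + \sum_i (w' ord0 i - v' ord0 i).
      by rewrite sumrB addrC subrK.
    have pos : 0 <= \sum_i (w' ord0 i - v' ord0 i).
      by apply: sumr_ge0 => i _; have /andP[] := vw i.
    have bnd : \sum_i (w' ord0 i - v' ord0 i) <= m%:Z.
      apply: le_trans (_ : \sum_(i < m) (1 : int) <= _).
        by apply: ler_sum => i _; have /andP[] := vw i.
      by rewrite sumr_const card_ord -mulr_natr mul1r natz.
    have modE : ((\sum_i v' ord0 i) %% m.+1)%Z = ((\sum_i w' ord0 i) %% m.+1)%Z.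
      have lt_mod (z : int) : (absz (z %% m.+1)%Z < m.+1)%N.
        by have := @ltz_pmod z m.+1; have := @modz_ge0 z m.+1; lia.
      move: cvw => /(congr1 val); rewrite /= !inordK // => e.
      have := @modz_ge0 (\sum_i v' ord0 i) m.+1.
      by have := @modz_ge0 (\sum_i w' ord0 i) m.+1; lia.
    have sum0 : \sum_i (w' ord0 i - v' ord0 i) = 0.
      move: modE pos bnd; rewrite sumE.
      move: (\sum_i v' ord0 i) (\sum_i (w' ord0 i - v' ord0 i)) => a b e b0 bm.
      have := divz_eq a m.+1; have := divz_eq (a + b) m.+1; rewrite -e.
      move: ((a %/ m.+1)%Z) (((a + b) %/ m.+1)%Z) ((a %% m.+1)%Z) => q r t E1 E2.
      have : b = (r - q) * m.+1%:Z by rewrite mulrBl; lia.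
      move=> bE; move: b0 bm; rewrite bE; move: (r - q) => d d0 dm.
      have [dn|dp] := leP d 0; last first.
        by have : m.+1%:Z <= d * m.+1%:Z; [rewrite ler_peMl //; lia | lia].
      by apply/eqP; rewrite eq_le d0 mulr_le0_ge0.
    have {}sum0 i : w' ord0 i - v' ord0 i = 0.
      have /eqP := sum0; rewrite psumr_eq0 => [/allP /(_ i)|j _]; last by have /andP[] := vw j.
      by rewrite mem_index_enum => /(_ isT) /eqP.
    by apply/rowP => i; have := sum0 i; rewrite (ord1 ord0); lia.
  have [vw|wv] := hat_chain vx wx; first exact: inj_le.
  by move=> /esym /(inj_le _ _ wv).
have /eqP <- : #|` (c @` s)%fset| == #|` s| by apply/card_in_imfsetP.
rewrite cardfE; apply: leq_trans (max_card _) _; rewrite /= -cardfE.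
rewrite -[X in (_ <= X)%N]card_ord -(card_finset predT).
by apply: fsubset_leq_card; apply/fsubsetP => i; rewrite !inE.
Qed.

End lattice.

(** * Covers of increasing index, chosen along the lattice *)

(** The level is raised by one as soon as the index has passed the threshold of
    the next level. *)
Lemma slow_levels (J : nat) (T : nat -> nat) : exists L : nat -> nat,
  [/\ forall i, (J <= L i)%N, {homo L : i j / (i <= j)%N},
      forall i, (L i.+1 <= (L i).+1)%N,
      forall i, (J < L i)%N -> (T (L i) <= i)%N &
      forall j, exists i, (j <= L i)%N].
Proof.
pose L := fix L i := if i is i'.+1 then
  if (T (L i').+1 <= i)%N then (L i').+1 else L i' else J.
have LS i : L i.+1 = if (T (L i).+1 <= i.+1)%N then (L i).+1 else L i by [].
have mono : {homo L : i j / (i <= j)%N}.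
  by apply: homo_leq => [//|j i l|i]; [exact: leq_trans | rewrite LS; case: ifP].
exists L; split => //.
- by move=> i; exact: (mono 0%N i).
- by move=> i; rewrite LS; case: ifP.
- elim=> [|i IH]; first by rewrite ltnn.
  by rewrite LS; case: ifP => // _ /IH; lia.
elim=> [|j [i ji]]; first by exists 0%N.
move: ji; rewrite leq_eqVlt => /orP[/eqP ji|]; last by exists i.
pose i' := maxn i (T j.+1); exists i'.+1; rewrite LS.
have : (j <= L i')%N by rewrite ji; apply: mono; exact: leq_maxl.
rewrite leq_eqVlt => /orP[/eqP <-|lt]; last by case: ifP => _; lia.
by rewrite ifT // /i'; have := leq_maxr i (T j.+1); lia.
Qed.

Section spheres_at_infinity.
Variables (R : realType) (k : nat).
Implicit Types (x p q : 'rV[R]_k.+1) (v w : 'rV[int]_k.+1).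

Lemma coord_le_enorm x i : `|x ord0 i| <= enorm x.
Proof.
rewrite -sqrtr_sqr /enorm ler_wsqrtr // (bigD1 i) //= lerDl.
by apply: sumr_ge0 => j _; rewrite sqr_ge0.
Qed.

Lemma continuous_radial (M : topologicalType) (h : 'rV[R]_k.+1 -> M) p :
  {within sphere R k, continuous h} -> p != 0 ->
  h (dir y) @[y --> p] --> h (dir p).
Proof.
move=> /subspace_continuousP hc p0 B hB.
have := dir_continuous p0 (hc (dir p) (dir_sphere p) B hB).
by rewrite /nbhs /=; apply: (@filterS _ (nbhs p)) => y yB; exact: yB (dir_sphere y).
Qed.

(** A Lebesgue number for the sphere and the composite of [h] with [dir], valid
    also for points [q] off the sphere; these occur as points of rescaled
    stars. *)
Lemma radial_lebesgue (M : topologicalType) (h : 'rV[R]_k.+1 -> M) (C : set (set M)) :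
  {within sphere R k, continuous h} -> C `<=` open -> \bigcup_(W in C) W = setT ->
  exists T : nat, forall p, sphere R k p -> exists2 W, C W &
    forall q, `|q - p| < T.+1%:R^-1 -> W (h (dir q)).
Proof.
move=> hc Co Ccov.
pose P (T : nat) p := exists2 W, C W & forall q, `|q - p| < T.+1%:R^-1 -> W (h (dir q)).
have /compact_near_coveringP /(_ nat \oo P _) H := @sphere_compact R k.
have [|T _ TP] := H _; last first.
  by exists T => p sp; exact: (TP T (leqnn T) p sp).
move=> p sp; have [W CW Wp] : (\bigcup_(W in C) W) (h (dir p)) by rewrite Ccov.
have p0 := sphere_neq0 sp.
have : \forall q \near p, W (h (dir q)).
  exact: (continuous_radial hc p0 (open_nbhs_nbhs (conj (Co W CW) Wp))).
move=> /nbhs_ballP [d /= d0 dW].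
exists (ball p (d / 2), [set T | T.+1%:R^-1 < d / 2]) => /=.
  split; first by apply: nbhsx_ballx; rewrite divr_gt0.
  by apply: (@cvgr_lt R _ \oo _ _ 0 (@cvg_harmonic R)); rewrite divr_gt0.
move=> [p' T] [/= pp' Td]; exists W => // q qp'; apply: dW.
move: pp'; rewrite -!ball_normE /= => pp'.
apply: le_lt_trans (ler_distD p' _ _) _; rewrite (splitr d) ltrD //.
by rewrite distrC; exact: lt_trans qp' Td.
Qed.

Definition int_norm v : nat := \max_i absz (v ord0 i).

Lemma int_norm_coord v i : (absz (v ord0 i) <= int_norm v)%N.
Proof. exact: (leq_bigmax i). Qed.

Lemma int_norm_step v w x : 0 < hat v x -> 0 < hat w x ->
  (int_norm w <= (int_norm v).+1)%N.
Proof.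
move=> vx wx; apply/bigmax_leqP => i _; have := int_norm_coord v i.
have [/(_ i)|/(_ i)] := hat_chain vx wx;
  move: (v _ _) (w _ _) (int_norm v) => a b c; lia.
Qed.

Lemma int_norm_far v x : 0 < hat v x -> `|x| < (int_norm v).+1%:R.
Proof.
move=> vx; rewrite [X in X < _]mx_normrE; apply: bigmax_lt => // -[i j] _ /=.
rewrite ord1; have := hat_near j vx; have := int_norm_coord v j.
rewrite -(ler_nat R) -(addn1 (int_norm v)) natrD natr_absz intr_norm.
have := ler_normD (x ord0 j - (v ord0 j)%:~R) (v ord0 j)%:~R.
rewrite subrK; lra.
Qed.

Lemma int_norm_le_enorm v : (int_norm v)%:R <= enorm (map_mx intr v : 'rV[R]_k.+1).
Proof.
have [i ->] : exists i, int_norm v = absz (v ord0 i).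
  have ord_gt0 : (0 < #|'I_k.+1|)%N by rewrite card_ord.
  by have [i iE] := bigop.eq_bigmax (fun i => absz (v ord0 i)) ord_gt0; exists i.
by rewrite natr_absz intr_norm; have := coord_le_enorm (map_mx intr v) i; rewrite mxE.
Qed.

(** Scaling by the inverse norm of the centre [v] preserves directions and moves
    the star of [v] within [1 / |v|] of a point of the sphere, so the Lebesgue
    numbers give thresholds for the levels.  The level [J] needs none since [W0] contains all values of [h]. *)
Lemma lattice_cover (M : topologicalType) (h : 'rV[R]_k.+1 -> M)
    (U : nat -> set (set M)) (J : nat) (W0 : set M) :
  {within sphere R k, continuous h} ->
  (forall j, U j `<=` open /\ \bigcup_(W in U j) W = setT) ->
  U J W0 -> (forall z, sphere R k z -> W0 (h z)) ->
  exists (lev : 'rV[int]_k.+1 -> nat) (W : 'rV[int]_k.+1 -> set M),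
    [/\ forall v, U (lev v) (W v) /\ (J <= lev v)%N,
        forall v w x, 0 < hat v x -> 0 < hat w x -> (lev w <= (lev v).+1)%N,
        forall v x, 0 < hat v x -> W v (h (dir x)) &
        forall j, exists N : R, forall v x, N <= `|x| -> 0 < hat v x -> (j <= lev v)%N].
Proof.
move=> hc Ucov UW0 hW0.
have [T TP] := choice (fun j => radial_lebesgue hc (Ucov j).1 (Ucov j).2).
have [L [JL Lmono Lstep LT Lub]] := slow_levels J (fun j => (T j).+1).
have WP v : exists W, U (L (int_norm v)) W /\ forall x, 0 < hat v x -> W (h (dir x)).
  have := JL (int_norm v); rewrite leq_eqVlt => /orP[/eqP <-|Jv].
    by exists W0; split => // x _; exact/hW0/dir_sphere.
  have Tv := LT _ Jv; set vR : 'rV[R]_k.+1 := map_mx intr v.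
  have vlarge : (T (L (int_norm v))).+1%:R <= enorm vR.
    by apply: le_trans (int_norm_le_enorm v); rewrite ler_nat.
  have v0 : 0 < enorm vR by apply: lt_le_trans vlarge.
  have [W UW WP] := TP (L (int_norm v)) _ (dir_sphere vR).
  exists W; split => // x vx.
  have iv : 0 < (enorm vR)^-1 by rewrite invr_gt0.
  rewrite -(dirZ x iv); apply: WP.
  have vR0 : vR != 0.
    apply: contraTneq v0 => ->.
    by rewrite /enorm big1 ?sqrtr0 ?ltxx // => i _; rewrite mxE expr0n.
  rewrite /dir (negPf vR0) -scalerBr normrZ gtr0_norm //.
  apply: lt_le_trans (_ : (enorm vR)^-1 <= _); last first.
    by rewrite lef_pV2 ?posrE.
  rewrite gtr_pMr //; rewrite [X in X < _]mx_normrE; apply: bigmax_lt => // -[i j] _ /=.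
  by rewrite !mxE ord1; exact: hat_near.
have [W WP'] := choice WP.
exists (L \o int_norm), W; split => [v|v w x vx wx|v x vx|j] /=.
- by split; [have [] := WP' v | exact: JL].
- exact: leq_trans (Lmono _ _ (int_norm_step vx wx)) (Lstep _).
- by have [_] := WP' v; apply.
have [i ji] := Lub j; exists i.+1%:R => v x ix vx.
apply: leq_trans ji _; apply: Lmono.
by have := le_lt_trans ix (int_norm_far vx); rewrite ltr_nat ltnS; lia.
Qed.

End spheres_at_infinity.

(** * From extensions to local connectedness *)

(** Each closed simplex of the zero-skeleton is a point. *)
Lemma skeleton0_continuous (R : realType) (V : choiceType) (K : set {fset V})
    (M : topologicalType) (f : realization R (skeleton 0 K) -> M) :
  is_complex K -> continuous f.
Proof.
move=> Kc; apply/continuousP => A _.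
suff : @realization_open R V (skeleton 0 K) (f @^-1` A) by [].
move=> s [Ks s1]; have /cardfs1P [v sv] : #|` s| == 1%N.
  by rewrite eqn_leq s1 cardfs_gt0 (Kc _ Ks).1.
have one (x y : realization R (skeleton 0 K)) :
    closed_simplex s x -> closed_simplex s y -> x = y.
  move=> /closed_simplex_cell + /closed_simplex_cell; rewrite sv => xv yv.
  by apply: realization_eq => u; rewrite (cell1 xv) (cell1 yv).
have [[x [Ax sx]]|nA] := pselect (f @^-1` A `&` closed_simplex s !=set0).
  exists setT; first exact: openT.
  apply/seteqP; split=> y [_ sy]; split => //.
  by rewrite (one y x sy sx).
exists set0; first exact: open0.
apply/seteqP; split=> y; last by case.
by move=> Ay; case: nA; exists y.
Qed.

Section small_simplexes.
Variables (R : realType) (M : metricType R).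

Lemma nbhs_lt_ereal (e : R) : 0 < e -> nbhs (0 : \bar R)%E [set z | (z < e%:E)%E].
Proof.
move=> e0; apply: open_nbhs_nbhs; split; last by rewrite /= lte_fin.
exact: open_ereal_lt_ereal.
Qed.

Lemma small_mesh (U : nat -> set (set M)) (e : R) : zero_sequence U -> 0 < e ->
  exists j, forall i W a b, (j <= i)%N -> U i W -> W a -> W b -> mdist a b < e.
Proof.
move=> [_ Um] e0.
have [j _ jP] : \forall i \near \oo, (mesh (U i) < e%:E)%E.
  exact: (Um _ (nbhs_lt_ereal e0)).
exists j => i W a b ji UW Wa Wb; rewrite -lte_fin.
apply: le_lt_trans (mdist_le_diam Wa Wb) _; apply: le_lt_trans (jP i ji).
by apply: ereal_sup_ubound; right; exists W.
Qed.

(** The condition on sequences is uniform: simplexes of increasing level that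
    violate a bound would form a sequence that violates it. *)
Lemma small_high_simplexes (V : Type) (S : set V) (lev : V -> nat) (F : V -> set M) (e : R) :
  (forall sigma : nat -> V, (forall k, S (sigma k)) -> lev (sigma k) @[k --> \oo] --> \oo ->
     diam (F (sigma k)) @[k --> \oo] --> (0 : \bar R)%E) -> 0 < e ->
  exists j, forall s, S s -> (j <= lev s)%N -> forall a b, F s a -> F s b -> mdist a b < e.
Proof.
move=> FS e0; apply: contrapT => /forallNP bad.
have [sigma sP] : exists sigma : nat -> V, forall j, [/\ S (sigma j), (j <= lev (sigma j))%N &
    (e%:E <= diam (F (sigma j)))%E].
  suff /choice [sigma] : forall j, exists s,
      [/\ S s, (j <= lev s)%N & (e%:E <= diam (F s))%E] by exists sigma.
  move=> j.
  apply: contrapT => /forallNP ns; apply: (bad j) => s Ss js a b Fa Fb.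
  rewrite ltNge; apply/negP => ab; apply: (ns s); split => //.
  by apply: le_trans (mdist_le_diam Fa Fb); rewrite lee_fin.
have Ss k : S (sigma k) by have [] := sP k.
have sl : lev (sigma k) @[k --> \oo] --> \oo.
  apply/cvgnyPge => j; exists j => // i /= ji.
  by have [_ il _] := sP i; exact: leq_trans ji il.
have [j _ jP] : \forall i \near \oo, (diam (F (sigma i)) < e%:E)%E.
  exact: (FS sigma Ss sl _ (nbhs_lt_ereal e0)).
have [_ _] := sP j.
by rewrite leNgt jP //=.
Qed.

End small_simplexes.

Lemma sphere_norm_ge (R : realType) k (z : 'rV[R]_k.+1) :
  sphere R k z -> 1 <= k.+1%:R * `|z|.
Proof.
move=> sz; rewrite -[leLHS]sz.
apply: le_trans (_ : \sum_(i < k.+1) `|z| <= _); last first.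
  by rewrite sumr_const card_ord mulr_natl.
apply: ler_sum => i _; rewrite -real_normK ?num_real // expr2.
apply: le_trans (coord_le_norm z i); rewrite ler_piMr //.
exact: sphere_coord_le.
Qed.

Section extension_at_infinity.
Variables (R : realType) (k : nat) (M : metricType R).
Variables (h : 'rV[R]_k.+1 -> M) (g : 'rV[R]_k.+1 -> M).
Hypothesis hc : {within sphere R k, continuous h}.
Hypothesis gc : continuous g.
Hypothesis gh : forall e, 0 < e ->
  exists N : R, forall x, N <= `|x| -> mdist (g x) (h (dir x)) < e.

(** The homotopy runs along rays, from infinity at time [0] to the origin at time
    [1], through the radial parameter [(1 - t) / t]. *)
Lemma null_homotopic_of_radial_limit (U : set M) :
  (forall x, U (g x)) -> (forall z, sphere R k z -> U (h z)) ->
  null_homotopic_in U h.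
Proof.
move=> gU hU.
pose H (tz : R * 'rV[R]_k.+1) :=
  if tz.1 == 0 then h tz.2 else g ((1 - tz.1) / tz.1 *: tz.2).
exists H, (g 0); split; last 3 first.
- by move=> t z _ sz; rewrite /H /=; case: ifP => _; [exact: hU | exact: gU].
- by move=> z sz; rewrite /H /= eqxx.
- by move=> z _; rewrite /H /= oner_eq0 subrr mul0r scale0r.
apply/subspace_continuousP => -[t0 z0] [/= ]; rewrite in_itv /= => /andP[t0ge t0le] sz0.
rewrite /from_subspace.
have [t00|t0n] := eqVneq t0 0; last first.
  have t0gt : 0 < t0 by rewrite lt_neqAle eq_sym t0n.
  have nt : \forall p \near (t0, z0), p.1 != 0.
    have := @cvg_fst R 'rV[R]_k.+1 (nbhs t0) (nbhs z0) _ [set r | r != 0]; apply.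
    exact: (open_nbhs_nbhs (conj (@open_neq R 0) t0n)).
  apply: cvg_within_filter.
  apply: (@cvg_near_eq _ _ (nbhs (t0, z0)) _ (fun p => g ((1 - p.1) / p.1 *: p.2))).
    by apply: filterS nt => p p0; rewrite /H (negPf p0).
  have rc : ((1 - p.1) / p.1 *: p.2) @[p --> (t0, z0)] --> (1 - t0) / t0 *: z0.
    apply: (@cvgZ _ _ _ (nbhs (t0, z0))); last exact: cvg_snd.
    apply: (@cvgM _ _ (nbhs (t0, z0))).
      apply: (@cvgB _ _ _ (nbhs (t0, z0))); last exact: cvg_fst.
      exact: (@cvg_cst R 1 _ (nbhs (t0, z0)) _).
    by apply: (@cvgV _ _ (nbhs (t0, z0))) => //; exact: cvg_fst.
  by rewrite /H /= (negPf t0n); exact: (cvg_comp _ _ rc (@gc _)).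
have H00 : H (t0, z0) = h z0 by rewrite /H t00 /= eqxx.
rewrite H00; apply/metricType_numDomainType.cvgrPdist_lt => e e0.
have e2 : 0 < e / 2 by rewrite divr_gt0.
have [N gN] := gh e2.
have hnear : \forall z \near z0, sphere R k z -> mdist (h z0) (h z) < e / 2.
  move/subspace_continuousP : hc => /(_ z0 sz0).
  move=> /metricType_numDomainType.cvgrPdist_lt /(_ _ e2).
  by rewrite near_withinE.
(* a point of the sphere has sup norm at least [1 / (k + 1)], so for [t < d] the
   point [(1 - t) / t *: z] has norm at least [N] *)
pose d : R := (k.+1%:R * (`|N| + 1) + 1)^-1.
have d0 : 0 < d by rewrite invr_gt0 ltr_wpDl // mulr_ge0 // addr_ge0.
rewrite near_withinE.
exists (ball t0 d, [set z | sphere R k z -> mdist (h z0) (h z) < e / 2]) => /=.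
  by split; [exact: nbhsx_ballx | exact: hnear].
move=> [t z] /= [td hz]; rewrite in_itv /= => -[/andP[t_ge t_le] sz].
have hz' := hz sz; rewrite /H /=; have [_|tn] := eqVneq t 0.
  by apply: lt_trans hz' _; rewrite ltr_pdivrMr // ltr_pMr // ltr1n.
have tgt : 0 < t by rewrite lt_neqAle eq_sym tn.
have rho_gt : k.+1%:R * (`|N| + 1) < (1 - t) / t.
  rewrite mulrBl mul1r divff // ltrBrDr -[ltLHS]invrK ltf_pV2 ?posrE //.
  by move: td; rewrite -ball_normE /= t00 sub0r normrN gtr0_norm.
have rho0 : 0 < (1 - t) / t.
  by apply: le_lt_trans rho_gt; rewrite mulr_ge0 // addr_ge0.
have far : N <= `|(1 - t) / t *: z|.
  rewrite normrZ gtr0_norm //; apply: le_trans (ler_norm N) _.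
  apply: le_trans (_ : (`|N| + 1) * (k.+1%:R * `|z|) <= _).
    apply: le_trans (_ : `|N| + 1 <= _); first by rewrite lerDl.
    by rewrite ler_peMr ?addr_ge0 // sphere_norm_ge.
  by rewrite mulrA [X in X * _]mulrC ler_wpM2r // ltW.
have := gN _ far; rewrite dirZ // dir_id // => gz.
rewrite (splitr e); apply: le_lt_trans (metric_triangle _ (h z) _) _.
by rewrite ltrD // metric_sym.
Qed.

End extension_at_infinity.

Lemma vertex_in_simplex (R : realType) (V : choiceType) (K : set {fset V}) s v
    (Kv : K [fset v]%fset) : v \in s -> closed_simplex s (vertex R Kv).
Proof. by move=> vs u us /=; have [uv|//] := eqVneq u v; rewrite uv vs in us. Qed.

Section extension_implies_LC.
Variables (R : realType) (n : nat) (M : metricType R) (U : nat -> set (set M)).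
Hypothesis U_zero : zero_sequence U.
Local Notation T := (Tel U).
Variable f : realization R (skeleton n.+1 T) -> M.
Hypothesis f_continuous : continuous f.
Hypothesis f_vertex : forall v (Tv : skeleton n.+1 T [fset v]%fset),
  v.2 (f (vertex R Tv)).
Hypothesis f_small : forall e, 0 < e -> exists j, forall s, skeleton n.+1 T s ->
  (j <= level U s)%N -> forall a b, (f @` closed_simplex s) a ->
  (f @` closed_simplex s) b -> mdist a b < e.

(** Over [x], the members of covers attached to the stars containing [x] share
    the point [h (dir x)] and have at most two consecutive indices, so they
    span a simplex of the telescope, of dimension at most [k.+1].  Its image
    is small and contains the image of a vertex, which lies with
    [h (dir x)] in a small member of a cover. *)
Lemma extension_null_homotopic k (h : 'rV[R]_k.+1 -> M) (J : nat) (W0 : set M) (e : R) :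
  (k <= n)%N -> {within sphere R k, continuous h} -> U J W0 ->
  (forall z, sphere R k z -> W0 (h z)) -> 0 < e ->
  (forall i W a b, (J <= i)%N -> U i W -> W a -> W b -> mdist a b < e) ->
  (forall s, skeleton n.+1 T s -> (J <= level U s)%N -> forall a b,
    (f @` closed_simplex s) a -> (f @` closed_simplex s) b -> mdist a b < e) ->
  forall B : set M, (forall z b, sphere R k z -> mdist b (h z) < 2 * e -> B b) ->
  null_homotopic_in B h.
Proof.
move=> kn hc UW0 hW0 e0 mesh_e simp_e B hB.
have Uc j : U j `<=` open /\ \bigcup_(W in U j) W = setT by have [/(_ j)] := U_zero.
have [lev [W [WU lev_step Wh lev_far]]] := lattice_cover hc Uc UW0 hW0.
pose om v := (lev v, W v).
have simplexP (x : 'rV[R]_k.+1) (s : {fset 'rV[int]_k.+1}) : (forall v, v \in s = (0 < hat v x)) ->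
    skeleton n.+1 T (om @` s)%fset /\
    forall j, (forall v, v \in s -> (j <= lev v)%N) -> (j <= level U (om @` s)%fset)%N.
  move=> sP; have [v0 v0x] := hat_cover x.
  have v0s : v0 \in s by rewrite sP.
  have exl : exists l, [exists v : s, lev (val v) == l].
    by exists (lev v0); apply/existsP; exists [` v0s]%fset.
  have [l /existsP [[v vs] /= /eqP vl] lmin] := ex_minnP exl.
  have lle u : u \in s -> (l <= lev u)%N.
    by move=> us; apply: lmin; apply/existsP; exists [` us]%fset.
  have nl : nerve_pair U l (om @` s)%fset.
    split.
    - by apply/fset0Pn; exists (om v0); apply: in_imfset.
    - move=> _ /imfsetP [u /= us ->].
      have [Uu _] := WU u; have := lle u us.
      have : (lev u <= l.+1)%N by rewrite -vl; apply: (lev_step v u x); rewrite -sP.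
      rewrite leq_eqVlt => /orP[/eqP lu _|lu ul]; first by right; rewrite /labelled /= -lu.
      by left; have -> : l = lev u by [apply/eqP; rewrite eqn_leq ul].
    - exists (h (dir x)) => _ /imfsetP [u /= us ->] /=.
      by apply: Wh; rewrite -sP.
  have Ts : T (om @` s)%fset by exists l.
  split; last first.
    move=> j js; apply: leq_trans (_ : l <= _)%N; first by rewrite -vl; exact: js.
    by have [_] := level_spec Ts; apply.
  split => //; apply: leq_trans (leq_imfset_card _ _ _) _.
  have cs : (#|` s| <= k.+2)%N by apply: (@card_hat R _ x) => w; rewrite sP.
  apply: leq_trans cs _.
  by rewrite !ltnS.
have [phi [phi_c phi_supp]] := partition_map (@skeleton_complex _ _ (@Tel_complex M U) n.+1)
  (@hat_ge0 R _) (@hat_continuous R _) (@hat_finite R _) (@hat_cover R _)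
  (fun x s sP => (simplexP x s sP).1).
(* used for [J] and [e], and for arbitrarily high levels far from the origin *)
have key j d : 0 < d ->
    (forall i W a b, (j <= i)%N -> U i W -> W a -> W b -> mdist a b < d) ->
    (forall s, skeleton n.+1 T s -> (j <= level U s)%N -> forall a b,
      (f @` closed_simplex s) a -> (f @` closed_simplex s) b -> mdist a b < d) ->
    forall x, (forall v, 0 < hat v x -> (j <= lev v)%N) ->
    mdist (f (phi x)) (h (dir x)) < 2 * d.
  move=> d0 mesh_d simp_d x xj.
  have [s sP] := active_fset (@hat_finite R _) x.
  have [Ts lev_s] := simplexP x s sP; have [v vx] := hat_cover x.
  have vs : v \in s by rewrite sP.
  have oms : om v \in (om @` s)%fset by apply: in_imfset.
  have Tv : skeleton n.+1 T [fset om v]%fset.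
    apply: (@skeleton_complex _ _ (@Tel_complex M U) n.+1 _ Ts).2; last by rewrite fsub1set.
    by rewrite -cardfs_gt0 cardfs1.
  have px : closed_simplex (om @` s)%fset (phi x).
    move=> u us; apply/eqP; apply: contraNT us => /phi_supp [w <- wx].
    by apply: in_imfset; rewrite /= sP.
  have js : (j <= level U (om @` s)%fset)%N.
    by apply: lev_s => u; rewrite sP; exact: xj.
  apply: le_lt_trans (metric_triangle _ (f (vertex R Tv)) _) _.
  rewrite mulr_natl mulr2n ltrD //.
    apply: (simp_d _ Ts js); first by exists (phi x).
    by exists (vertex R Tv) => //; exact: vertex_in_simplex.
  by apply: (mesh_d _ (W v)) (xj v vx) (WU v).1 (f_vertex Tv) (Wh v x vx).
have near (x : 'rV[R]_k.+1) : mdist (f (phi x)) (h (dir x)) < 2 * e.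
  by apply: (key J) => // v _; have [] := WU v.
apply: (@null_homotopic_of_radial_limit R k M h (f \o phi)) => //.
- by move=> x; apply: continuous_comp; [exact: phi_c | exact: f_continuous].
- move=> d d0; have d2 : 0 < d / 2 by rewrite divr_gt0.
  have [j1 P1] := small_mesh U_zero d2; have [j2 P2] := f_small d2.
  have [N NP] := lev_far (maxn j1 j2); exists N => x Nx.
  rewrite -[d](@mulfVK _ 2) // [_ * 2]mulrC.
  apply: (key (maxn j1 j2)) => [//|i A a b|s Ts|v vx].
  + by rewrite geq_max => /andP[ij _]; exact: P1.
  + by rewrite geq_max => /andP[_ ij]; exact: P2.
  + exact: NP vx.
- by move=> x; apply: (hB (dir x)) (near x); exact: dir_sphere.
- by move=> z sz; apply: (hB z) => //; rewrite mdistxx mulr_gt0.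
Qed.

Lemma extension_LC : LC R n M.
Proof.
move=> x O Oo Ox; have [d /= d0 dO] := (nbhs_ballP x O).1 (open_nbhs_nbhs (conj Oo Ox)).
have e0 : 0 < d / 3 by rewrite divr_gt0.
have [j1 P1] := small_mesh U_zero e0; have [j2 P2] := f_small e0.
pose J := maxn j1 j2.
have [Uo Uc] : open_cover (U J) by have [/(_ J)] := U_zero.
have [W UW Wx] : (\bigcup_(W in U J) W) x by rewrite Uc.
exists W; first exact: (open_nbhs_nbhs (conj (Uo W UW) Wx)).
have mesh_J i A a b : (J <= i)%N -> U i A -> A a -> A b -> mdist a b < d / 3.
  by rewrite geq_max => /andP[ij _]; exact: P1.
move=> k h kn hc hW.
have hW' z : sphere R k z -> W (h z) by move=> sz; apply: hW; exists z.
apply: (extension_null_homotopic kn hc UW hW' e0 mesh_J) => [s Ts|z b sz bz].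
  by rewrite geq_max => /andP[_ ij]; exact: P2.
apply: dO; rewrite ballEmdist /=.
have := mesh_J J W x (h z) (leqnn J) UW Wx (hW' z sz).
have := metric_triangle x (h z) b; rewrite (metric_sym (h z) b).
move: bz; lra.
Qed.

End extension_implies_LC.

Theorem proposition2p8 (R : realType) (n : nat) (M : metricType R) :
  LC R n M <->
  exists2 U : nat -> set (set M), zero_sequence U &
    forall K : set {fset nat * set M}, subcomplex K (Tel U) ->
    forall f0 : realization R (skeleton 0 K) -> M, continuous f0 ->
    (forall (v : nat * set M) (Kv : skeleton 0 K [fset v]%fset),
        v.2 (f0 (vertex R Kv))) ->
    exists f : realization R (skeleton n.+1 K) -> M,
      [/\ continuous f,
          forall x, f (realization_incl (skeletonS (leq0n n.+1)) x) = f0 x &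
          forall sigma : nat -> {fset nat * set M},
            (forall k, skeleton n.+1 K (sigma k)) ->
            level U (sigma k) @[k --> \oo] --> \oo ->
            diam (f @` closed_simplex (sigma k)) @[k --> \oo] --> (0 : \bar R)%E].
Proof.
split=> [lc|[U Uz ext]].
  exists (fine_cover n); first exact: fine_cover_zero_sequence.
  by move=> K KT f0 _; exact: LC_extension.
have Tc := @Tel_complex M U.
have [f0 f0P] : exists f0 : realization R (skeleton 0 (Tel U)) -> M,
    forall (v : nat * set M) (Kv : skeleton 0 (Tel U) [fset v]%fset),
      v.2 (f0 (vertex R Kv)).
  suff /choice [f0 f0P] : forall y : realization R (skeleton 0 (Tel U)), exists p : M,
      forall v (Kv : skeleton 0 (Tel U) [fset v]%fset), y = vertex R Kv -> v.2 p.
    by exists f0 => v Kv; exact: f0P.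
  move=> y; have [w [Kw yw]] := skeleton0_vertex y Tc.
  have [[k _ [_ _ [c cw]]] _] := Kw.
  exists c => v Kv yv; suff -> : v = w by apply: cw; rewrite /= inE.
  have : bary y v = 1 by rewrite yv /= eqxx.
  by rewrite yw /=; case: eqVneq => // _ /eqP; rewrite eq_sym oner_eq0.
have [|f [fc fv fd]] := ext (Tel U) _ f0 (skeleton0_continuous Tc) f0P.
  by split.
apply: (extension_LC Uz fc) => [v Tv|e e0].
  have Kv : skeleton 0 (Tel U) [fset v]%fset.
    by case: Tv => Tv _; split; rewrite ?cardfs1.
  suff -> : vertex R Tv = realization_incl (skeletonS (leq0n n.+1)) (vertex R Kv).
    by rewrite fv; exact: f0P.
  exact: realization_eq.
exact: small_high_simplexes fd e0.
Qed.
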